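(* Let $v,w\in V$. Then $F_v(z)F_w(z)=F_{v\,\overline{*}\,w}(z)$ for every $z\in\mathbb{C}$ with $\operatorname{Re}z>-1$.
   Context: $\mathbb{N}=\{0,1,2,\ldots\}$. A multi-index is a nonempty finite sequence $\mu=(\mu_1,\ldots,\mu_p)$ of positive integers, of length $l(\mu)=p$. $V$ is the $\mathbb{Q}$-vector space with basis the set of all multi-indices. Product $\overline{*}$: for multi-indices $\mu,\nu$, let $\mathcal{H}_{\mu,\nu}$ be the set of all $2\times l$ matrices $M=(m_{ij})$ ($l\ge1$ arbitrary) with non-negative integer entries such that deleting the zeros from the first row gives $\mu$, deleting the zeros from the second row gives $\nu$, and $m_{1j}+m_{2j}>0$ for all $1\le j\le l$. Define $$\mu\,\overline{*}\,\nu=\sum_{M\in\mathcal{H}_{\mu,\nu}}(-1)^{l(\mu)+l(\nu)-l}(m_{11}+m_{21},\ldots,m_{1l}+m_{2l})\in V,$$ where $l$ is the number of columns of $M$; extend bilinearly to $V\times V$. For a multi-index $\mu$ and $n\in\mathbb{N}$, $S_{\mu}(n)=\sum_{0\le n_1\le\cdots\le n_p<n}\frac{1}{(n_1+1)^{\mu_1}\cdots(n_p+1)^{\mu_p}}$; extend $\mu\mapsto S_\mu\in\mathbb{C}^{\mathbb{N}}$ linearly to $v\mapsto S_v$ on $V$. For $a\in\mathbb{C}^{\mathbb{N}}$, $(\nabla a)(n)=\sum_{k=0}^n(-1)^k\binom{n}{k}a(k)$. For $v\in V$, $$F_v(z)=\sum_{n=0}^{\infty}(-1)^n(\nabla S_v)(n)\binom{z}{n},\qquad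 \binom{z}{n}=\frac{z(z-1)\cdots(z-n+1)}{n!},$$ a series which converges for all $z\in\mathbb{C}$ with $\operatorname{Re}z>-1$. *)

(* Defs.v *)
From HB Require Import structures.
From mathcomp Require Import all_boot all_order all_algebra finmap.
From mathcomp Require Import complex monalg.
From mathcomp Require Import all_classical all_reals all_analysis.

Set Implicit Arguments.
Unset Strict Implicit.
Unset Printing Implicit Defensive.

Import Order.TTheory GRing.Theory Num.Theory numFieldNormedType.Exports.

Local Open Scope classical_set_scope.
Local Open Scope ring_scope.

Record multiindex := MultiIndex {
  mi_seq :> seq nat;
  _ : (mi_seq != [::]) && all (fun m => 0 < m)%N mi_seq }.

HB.instance Definition _ := [isSub for mi_seq].
HB.instance Definition _ := [Choice of multiindex by <:].

Definition multiindex1 : multiindex := @MultiIndex [:: 1%N] isT.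

(* Junk value [multiindex1] when [s] is empty or has a zero entry. *)
Definition to_multiindex (s : seq nat) : multiindex := insubd multiindex1 s.

Definition mi_space := {malg rat[multiindex]}.

Definition nonzero_row (l : nat) (M : 'M[nat]_(2, l)) (i : 'I_2) : seq nat :=
  [seq m <- [seq M i j | j <- enum 'I_l] | m != 0%N].

Definition colsums (l : nat) (M : 'M[nat]_(2, l)) : seq nat :=
  [seq (M ord0 j + M ord_max j)%N | j <- enum 'I_l].

(* Matrices of all widths; [tag] is the width and [tagged] the matrix. *)
Definition mat2 := {l : nat & 'M[nat]_(2, l)}.

Definition quasi_shuffles (mu nu : multiindex) : set mat2 :=
  [set M : mat2 | [/\ (0 < tag M)%N,
               nonzero_row (tagged M) ord0 = mu,
               nonzero_row (tagged M) ord_max = nu &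
               forall j : 'I_(tag M),
                 (0 < tagged M ord0 j + tagged M ord_max j)%N]].

(* The summation over a set below is the finitely supported one, and the
   exponent of -1 is a truncated subtraction; the next lemmas show that both
   have their usual meaning, and that [to_multiindex] returns no junk. *)
Lemma quasi_shuffles_width mu nu (M : mat2) :
  quasi_shuffles mu nu M -> (tag M <= size mu + size nu)%N.
Proof.
case: M => l M [] /= _ <- <- Mpos.
have sizeE i : size (nonzero_row M i) = count (fun j => M i j != 0%N) (enum 'I_l).
  by rewrite size_filter count_map.
rewrite !sizeE -[X in (X <= _)%N](size_enum_ord l).
rewrite -(count_predT (enum _)) -count_predUI.
apply: leq_trans (leq_addr _ _); apply: sub_count => j _ /=.
by have := Mpos j; rewrite addn_gt0 !lt0n.
Qed.

Lemma colsums_multiindex mu nu (M : mat2) : quasi_shuffles mu nu M ->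
  to_multiindex (colsums (tagged M)) = colsums (tagged M) :> seq nat.
Proof.
case: M => l M [] /= l_gt0 _ _ Mpos.
rewrite /to_multiindex; apply: insubdK; rewrite unfold_in; apply/andP; split.
  by rewrite -size_eq0 size_map size_enum_ord -lt0n.
by apply/allP => _ /mapP[j _ ->]; exact: Mpos.
Qed.

Lemma finite_quasi_shuffles mu nu : finite_set (quasi_shuffles mu nu).
Proof.
pose B := (size mu + size nu)%N; pose K := (sumn mu + sumn nu)%N.
pose f l (N : 'M['I_K.+1]_(2, l)) : mat2 :=
  Tagged (fun l => 'M[nat]_(2, l)) (map_mx val N).
apply: (@sub_finite_set _ _ (\bigcup_(l in `I_B.+1) range (@f l))); last first.
  apply: bigcup_finite => [|l _]; first exact: finite_II.
  exact/finite_image/finite_finset.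
move=> M HM; have wM := quasi_shuffles_width HM.
case: M HM wM => l M [] /= _ rmu rnu _ wM; exists l => //=.
exists (map_mx inord M) => //; rewrite /f; congr existT.
apply/matrixP => i j; rewrite !mxE /= inordK // ltnS.
have memle s m : m \in s -> (m <= sumn s)%N.
  elim: s => //= a s IHs; rewrite inE => /orP[/eqP ->|/IHs ms].
    exact: leq_addr.
  exact: leq_trans ms (leq_addl _ _).
have [-> //|Mij] := eqVneq (M i j) 0%N.
have Mrow : M i j \in nonzero_row M i.
  by rewrite mem_filter Mij map_f // mem_enum.
have [iE|iE] : i = ord0 \/ i = ord_max.
- by case: i {Mij Mrow} => [[|[|//]] ?]; [left|right]; apply: val_inj.
- by rewrite iE rmu -iE in Mrow; exact: leq_trans (memle _ _ Mrow) (leq_addr _ _).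
- by rewrite iE rnu -iE in Mrow; exact: leq_trans (memle _ _ Mrow) (leq_addl _ _).
Qed.

Definition mi_prod (mu nu : multiindex) : mi_space :=
  \sum_(M \in quasi_shuffles mu nu)
    (-1) ^+ (size mu + size nu - tag M) *:
      (<< to_multiindex (colsums (tagged M)) >> : mi_space).

Definition bar_prod (v w : mi_space) : mi_space :=
  \sum_(mu <- msupp v) \sum_(nu <- msupp w)
    (v@_mu * w@_nu) *: mi_prod mu nu.

Section Kawashima.
Variable R : realType.

Definition mi_sum (mu : multiindex) (n : nat) : R[i] :=
  \sum_(t : (size mu).-tuple 'I_n | sorted leq [seq val k | k <- t])
    \prod_(j < size mu) ((tnth t j).+1%:R ^+ nth 0%N mu j)^-1.

Definition mi_sumV (v : mi_space) (n : nat) : R[i] :=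
  \sum_(mu <- msupp v) ratr v@_mu * mi_sum mu n.

Definition nabla (a : nat -> R[i]) (n : nat) : R[i] :=
  \sum_(k < n.+1) (-1) ^+ k * 'C(n, k)%:R * a k.

Definition binomC (z : R[i]) (n : nat) : R[i] :=
  (\prod_(k < n) (z - k%:R)) / n`!%:R.

(* [R[i]^o] carries the topology given by the complex modulus. *)
Definition kawashimaF (v : mi_space) (z : R[i]) : R[i] :=
  limn (series (fun n => (-1) ^+ n * nabla (mi_sumV v) n * binomC z n)
          : nat -> R[i]^o).

End Kawashima.

(* Main.v *)
(** The functions [F_s], indexed by the entries of a multi-index read backwards,
    are Newton series [sum_n (-1)^n b_n binom(z, n+1)] whose coefficients [b] are
    obtained from the constant 1 by dividing by [n+1] and by taking Cesaro means.
    These two operations correspond to division by [z+1], so that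
    [F_(a :: s)(z+1) - F_(a :: s)(z) = F_s(z+1) / (z+1)^a]; at natural numbers
    this is the recursion of the sums [S].  The quasi-shuffle product obeys the
    recursion which this difference equation imposes on [F_s F_t].  Hence, by
    induction, the difference of the two sides of the theorem is 1-periodic on
    [Re z > -1] and vanishes at 0.

    It vanishes everywhere because [F_s(z+N) - F_s(N) = O(log^k N / N)] while
    [F_s(N) = O(log^k N)].  Indeed the N-th forward difference of [b] is at most
    [H_(n+N)^k / (n+N+1)], [H] being a harmonic sum, and [F_s(z+N) - F_s(N)] is
    the Newton series built on these differences. *)
Require Import Defs.
From mathcomp Require Import all_boot all_order all_algebra finmap.
From mathcomp Require Import complex monalg.
From mathcomp Require Import all_classical all_reals all_analysis.
From mathcomp Require Import ring lra.
Import Order.TTheory GRing.Theory Num.Theory numFieldNormedType.Exports.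
Local Open Scope ring_scope.
Set Implicit Arguments.
Unset Strict Implicit.
Unset Printing Implicit Defensive.

(** * Harmonic sums *)

Section Harmonic.
Variable R : realType.

(** The leading 1 keeps every value at least 1, even at [n = 0], so that the sum of two values is at
    most twice their product. *)
Definition harm (n : nat) : R := 1 + \sum_(i < n) i.+1%:R^-1.

Lemma harm0 : harm 0 = 1.
Proof. by rewrite /harm big_ord0 addr0. Qed.

Lemma harmS n : harm n.+1 = harm n + n.+1%:R^-1.
Proof. by rewrite /harm big_ord_recr /= addrA. Qed.

Lemma harm_ge1 n : 1 <= harm n.
Proof. by rewrite /harm lerDl sumr_ge0 // => i _; rewrite invr_ge0. Qed.

Lemma harm_gt0 n : 0 < harm n.
Proof. exact: lt_le_trans ltr01 (harm_ge1 n). Qed.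

Lemma harm_ge0 n : 0 <= harm n.
Proof. exact/ltW/harm_gt0. Qed.

Lemma harmD_le m n : harm (m + n) <= harm m + harm n.
Proof.
elim: n => [|n IHn]; first by rewrite addn0 lerDl harm_ge0.
rewrite addnS !harmS addrA lerD // lef_pV2 ?posrE ?ltr0n // ler_nat.
by rewrite ltnS leq_addl.
Qed.

(** This product form separates a shift from a summation index: one factor bounds the growth in the
    shift, the other stays under the sum. *)
Lemma harmD_leM m n : harm (m + n) <= 2 * harm m * harm n.
Proof.
apply: le_trans (harmD_le m n) _.
by have := harm_ge1 m; have := harm_ge1 n; nra.
Qed.

Lemma harm_le m n : (m <= n)%N -> harm m <= harm n.
Proof.
move=> /subnK <-; elim: (n - m)%N => [//|k IHk]; rewrite addSn harmS.
by rewrite (le_trans IHk) // lerDl invr_ge0.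
Qed.

Lemma expR_harm_ge n : n.+1%:R <= expR (harm n) :> R.
Proof.
elim: n => [|n IHn].
  by rewrite harm0; apply: le_trans (expR_ge1Dx 1); lra.
rewrite harmS expRD; apply: le_trans (ler_pM _ _ IHn (expR_ge1Dx _)) => //.
by rewrite mulrDr mulr1 mulfV // natr1.
Qed.

Lemma expR_harm_le n : expR (harm n) <= expR 2 * n.+1%:R :> R.
Proof.
case: n => [|n].
  by rewrite harm0 mulr1 ler_expR; lra.
have -> : (n.+2%:R : R) = n.+1%:R + 1 by rewrite natr1.
(* The induction needs this shifted, sharper bound: its growth factor e^(1/(n+2)) is at most
   (n+2)/(n+1), whereas the unshifted bound would require e^(1/(n+1)) <= (n+2)/(n+1), which
   fails. *)
suff: expR (harm n.+1) <= expR 2 * n.+1%:R :> R.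
  by move=> /le_trans; apply; rewrite ler_pM2l ?expR_gt0 // lerDl.
elim: n => [|n IHn].
  by rewrite harmS harm0 invr1 mulr1.
rewrite harmS expRD.
have e_le : expR n.+2%:R^-1 <= n.+2%:R / n.+1%:R :> R.
  rewrite -[leLHS]invrK -expRN -[leRHS]invrK.
  rewrite lef_pV2 ?posrE ?invr_gt0 ?divr_gt0 ?ltr0n ?expR_gt0 //.
  apply: le_trans (expR_ge1Dx _); rewrite invf_div.
  have -> : n.+1%:R = n.+2%:R - 1 :> R by rewrite -[n.+2%:R]natr1 addrK.
  by rewrite mulrBl mulfV ?pnatr_eq0 // mul1r.
apply: le_trans (ler_pM _ _ IHn e_le) _ => //; rewrite ?expR_ge0 //.
by rewrite -mulrA [X in _ * X]mulrC divfK // pnatr_eq0.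
Qed.

Lemma pow_expR_bound (c : R) k : 0 < c ->
  exists C, forall x, 0 <= x -> x ^+ k <= C * expR (c * x).
Proof.
(* With d = c/(k+1), the inequality d x <= exp(d x) is raised to the power k, and k d <= c. The
   denominator k+1 also covers k = 0. *)
move=> c_gt0; exists ((c / k.+1%:R)^-1 ^+ k) => x x_ge0.
have d_gt0 : 0 < c / k.+1%:R by rewrite divr_gt0.
set d := c / _ in d_gt0 *.
have x_le : x <= d^-1 * expR (d * x).
  rewrite -(ler_pM2l d_gt0) mulrA mulfV ?gt_eqF // mul1r.
  by apply: le_trans (expR_ge1Dx _); rewrite lerDr.
apply: le_trans (lerXn2r k _ _ x_le) _; rewrite ?nnegrE //.
  by rewrite mulr_ge0 ?expR_ge0 // invr_ge0 ltW.
rewrite exprMn ler_pM2l ?exprn_gt0 ?invr_gt0 // -expRM_natl ler_expR.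
rewrite mulrA ler_wpM2r // /d mulrC -mulrA ler_piMr ?(ltW c_gt0) //.
by rewrite mulrC ler_pdivrMr // mul1r ler_nat.
Qed.

(* Each term is dominated by an increment of -exp(-c harm n), up to the factor
   exp(c) / c, so the sum telescopes. *)
Lemma sum_expR_harm (c : R) M : 0 < c ->
  \sum_(n < M) expR (- (c * harm n)) / n.+1%:R <= expR c / c.
Proof.
move=> c_gt0; have c_neq0 : c != 0 by rewrite gt_eqF.
suff: \sum_(n < M) expR (- (c * harm n)) / n.+1%:R <=
    expR c / c * (1 - expR (- (c * harm M))).
  move=> /le_trans; apply; rewrite ler_piMr ?gerBl ?expR_ge0 //.
  by rewrite divr_ge0 ?expR_ge0 // ltW.
elim: M => [|M IHM].
  rewrite big_ord0 harm0 mulr_ge0 //; first by rewrite divr_ge0 ?expR_ge0 // ltW.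
  by rewrite subr_ge0 expR_le1 oppr_le0 mulr1 ltW.
rewrite big_ord_recr /=; apply: le_trans (lerD IHM (lexx _)) _.
set x := M.+1%:R^-1.
have x_gt0 : 0 < x by rewrite invr_gt0.
have x_le1 : x <= 1 by rewrite invf_le1 // ler1n.
have -> : expR (- (c * harm M)) = expR (- (c * harm M.+1)) * expR (c * x).
  by rewrite -expRD harmS; congr expR; rewrite -/x; ring.
set E := expR (- _); set e := expR (c * x); set A := expR c.
have E_gt0 : 0 < E by exact: expR_gt0.
have e_gt0 : 0 < e by exact: expR_gt0.
have e_le : e <= A by rewrite ler_expR ler_piMr // ltW.
have e_ge : 1 + c * x <= e by exact: expR_ge1Dx.
have cx_le : c * x * e <= A * (e - 1).
  by rewrite mulrC; apply: ler_pM; [exact: ltW|rewrite mulr_ge0 // ltW|by []|lra].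
have : A / c * (E * (e - 1)) - E * (e * x) = E / c * (A * (e - 1) - c * x * e).
  by field.
have : 0 <= E / c * (A * (e - 1) - c * x * e).
  by rewrite mulr_ge0 ?divr_ge0 ?subr_ge0 // ltW.
lra.
Qed.

(** Half of the exponent absorbs the power of [harm n]; the other half makes the sum bounded. *)
Lemma sum_harm_pow_expR (c : R) k : 0 < c -> exists D, forall M,
  \sum_(n < M) harm n ^+ k * expR (- (c * harm n)) / n.+1%:R <= D.
Proof.
move=> c_gt0; have c2_gt0 : 0 < c / 2 by rewrite divr_gt0.
have [C HC] := pow_expR_bound k c2_gt0.
have C_ge0 : 0 <= C.
  move: (HC 1 ler01); rewrite expr1n => /(le_trans ler01).
  by rewrite pmulr_lge0 ?expR_gt0.
exists (C * (expR (c / 2) / (c / 2))) => M.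
apply: le_trans (ler_wpM2l C_ge0 (sum_expR_harm M c2_gt0)).
rewrite mulr_sumr ler_sum // => n _; rewrite mulrA ler_wpM2r ?invr_ge0 //.
apply: le_trans (ler_wpM2r (expR_ge0 _) (HC _ (harm_ge0 n))) _.
rewrite -(mulrA C) -expRD le_eqVlt; apply/orP; left; apply/eqP.
by congr (_ * expR _); field.
Qed.

Lemma harm_cvg_pinfty : (harm n @[n --> \oo] --> +oo)%classic.
Proof.
have := nondecreasing_dvgn_lt _ (@dvg_harmonic R).
have nd : nondecreasing_seq (series (@harmonic R)).
  by apply: nondecreasing_series => n _ _; exact: harmonic_ge0.
move=> /(_ nd) H; apply: ger_cvgy H.
by near=> n; rewrite /harm /series /= big_mkord lerDr.
Unshelve. all: by end_near.
Qed.

Lemma harm_pow_expR_cvg0 (c : R) k : 0 < c ->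
  (harm n ^+ k * expR (- (c * harm n)) @[n --> \oo] --> (0 : R))%classic.
Proof.
(* The exponent k+1 leaves a spare factor 1 / [harm n], which tends to 0. *)
move=> c_gt0; have [C HC] := pow_expR_bound k.+1 c_gt0.
have : (C * (harm n)^-1 @[n --> \oo] --> (C * 0 : R))%classic.
  apply: cvgMr; apply/gtr0_cvgV0; first by near=> n; exact: harm_gt0.
  exact: harm_cvg_pinfty.
rewrite mulr0; apply: squeeze_cvgr; last exact: cvg_cst.
near=> n; rewrite mulr_ge0 ?exprn_ge0 ?harm_ge0 ?expR_ge0 //=.
rewrite ler_pdivlMr ?harm_gt0 // mulrAC -exprSr expRN.
by rewrite ler_pdivrMr ?expR_gt0 // HC // harm_ge0.
Unshelve. all: by end_near.
Qed.

Lemma harm_pow_cvg0 (k : nat) :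
  (harm n ^+ k / n.+1%:R @[n --> \oo] --> (0 : R))%classic.
Proof.
have : (expR 2 * (harm n ^+ k * expR (- (1 * harm n))) @[n --> \oo] -->
    (expR 2 * 0 : R))%classic.
  by apply: cvgMr; exact: harm_pow_expR_cvg0.
rewrite mulr0; apply: squeeze_cvgr; last exact: cvg_cst.
near=> n; rewrite divr_ge0 ?exprn_ge0 ?harm_ge0 //= mulrCA.
rewrite ler_wpM2l ?exprn_ge0 ?harm_ge0 // mul1r expRN.
rewrite ler_pdivlMr ?expR_gt0 // mulrC ler_pdivrMr //.
exact: expR_harm_le.
Unshelve. all: by end_near.
Qed.

End Harmonic.

(** * Complex series and binomial coefficients *)

Section ComplexSeries.
Variable R : realType.
Local Open Scope complex_scope.
Local Notation normc := (@complex.ComplexField.Normc.normc R).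
Local Notation Re := complex.Re.
Local Notation Im := complex.Im.

Lemma normc_ge0 (z : R[i]) : 0 <= normc z.
Proof. by case: z => a b; exact: sqrtr_ge0. Qed.

Lemma normcD_le (x y : R[i]) : normc (x + y) <= normc x + normc y.
Proof. exact: le_normcD. Qed.

Lemma normc_real (x : R) : normc x%:C = `|x|.
Proof. by rewrite /= expr0n /= addr0 sqrtr_sqr. Qed.

Lemma normcNE (x : R[i]) : normc (- x) = normc x.
Proof. exact: normcN. Qed.

Lemma normcX_sign n : normc ((-1) ^+ n) = 1.
Proof.
elim: n => [|n IHn]; first by rewrite expr0 ComplexField.Normc.normc1.
by rewrite exprS ComplexField.Normc.normcM IHn normcNE ComplexField.Normc.normc1 mulr1.
Qed.

Lemma normc_Re_le (z : R[i]) : `|Re z| <= normc z.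
Proof.
by case: z => a b /=; rewrite -sqrtr_sqr ler_wsqrtr // lerDl sqr_ge0.
Qed.

Lemma normc_Im_le (z : R[i]) : `|Im z| <= normc z.
Proof.
by case: z => a b /=; rewrite -sqrtr_sqr ler_wsqrtr // lerDr sqr_ge0.
Qed.

Lemma normc_le_ReIm (z : R[i]) : normc z <= `|Re z| + `|Im z|.
Proof.
case: z => a b /=.
rewrite -[leRHS]ger0_norm ?addr_ge0 // -sqrtr_sqr ler_wsqrtr //.
rewrite sqrrD !real_normK ?num_real //.
by rewrite lerD2r lerDl mulrn_wge0 // mulr_ge0.
Qed.

Lemma normc_sum_le n (f : nat -> R[i]) :
  normc (\sum_(k < n) f k) <= \sum_(k < n) normc (f k).
Proof.
elim: n => [|n IHn]; first by rewrite !big_ord0 ComplexField.Normc.normc0.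
by rewrite !big_ord_recr /= (le_trans (normcD_le _ _)) // lerD2r.
Qed.

Lemma cvgc_normcP (u : nat -> R[i]^o) (l : R[i]^o) :
  (u @ \oo --> l)%classic <-> (normc (u n - l) @[n --> \oo] --> (0 : R))%classic.
Proof.
split=> [/cvgrPdist_lt H|/cvgrPdist_lt H].
  apply/cvgrPdist_lt => e e_gt0; have e_gt0' : 0 < e%:C by rewrite ltcR.
  apply: filterS (H _ e_gt0') => n lt_e.
  rewrite sub0r normrN ger0_norm ?normc_ge0 // -normcNE opprB -ltcR.
  exact: lt_e.
(* A positive element of [R[i]] has imaginary part 0, so the radius is a real number. *)
apply/cvgrPdist_lt => e; case: e => e e'; rewrite ltcE /= => /andP[/eqP -> e_gt0].
apply: filterS (H _ e_gt0) => n; rewrite sub0r normrN ger0_norm ?normc_ge0 //.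
by rewrite -normcNE opprB => lt_e; have : (normc (l - u n))%:C < e%:C by rewrite ltcR.
Qed.

Lemma normc_lim_le (u : nat -> R[i]^o) (l : R[i]^o) (D : R) :
  (u @ \oo --> l)%classic -> (forall n, normc (u n) <= D) -> normc l <= D.
Proof.
move=> /cvgc_normcP /cvgrPdist_lt H uD; rewrite leNgt; apply/negP => Dl.
have e_gt0 : 0 < normc l - D by rewrite subr_gt0.
have [n _ /(_ n (leqnn n))] := H _ e_gt0; apply/negP; rewrite -leNgt.
rewrite sub0r normrN ger0_norm ?normc_ge0 // lerBlDr.
have -> : l = - (u n - l) + u n by ring.
apply: le_trans (normcD_le _ _) _; rewrite normcNE; apply: lerD (uD n).
by rewrite opprB addrNK.
Qed.

Lemma real_series_cvg (f : nat -> R) (g : nat -> R) (D : R) :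
  (forall n, `|f n| <= g n) -> (forall M, \sum_(n < M) g n <= D) ->
  cvgn (series f).
Proof.
move=> fg gD; apply: normed_cvg.
apply: nondecreasing_is_cvgn.
  by apply: nondecreasing_series => n _ _ /=; exact: normr_ge0.
exists D => _ [n _ <-]; apply: le_trans (gD n).
by rewrite /normed_series_of seriesEord; apply: ler_sum => i _; exact: fg.
Qed.

Lemma Re_sum n (f : nat -> R[i]) :
  Re (\sum_(k < n) f k) = \sum_(k < n) Re (f k).
Proof.
elim: n => [|n IHn]; first by rewrite !big_ord0.
by rewrite !big_ord_recr /= -IHn; case: (bigop _ _ _); case: (f n).
Qed.

Lemma Im_sum n (f : nat -> R[i]) :
  Im (\sum_(k < n) f k) = \sum_(k < n) Im (f k).
Proof.
elim: n => [|n IHn]; first by rewrite !big_ord0.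
by rewrite !big_ord_recr /= -IHn; case: (bigop _ _ _); case: (f n).
Qed.

Lemma complex_series_cvg (f : nat -> R[i]) (D : R) :
  (forall M, \sum_(n < M) normc (f n) <= D) ->
  exists2 L : R[i],
    ((series f : nat -> R[i]^o) @ \oo --> (L : R[i]^o))%classic & normc L <= D.
Proof.
move=> fD.
have /cvg_ex[a Ha] := real_series_cvg (fun n => normc_Re_le (f n)) fD.
have /cvg_ex[b Hb] := real_series_cvg (fun n => normc_Im_le (f n)) fD.
have HL : ((series f : nat -> R[i]^o) @ \oo --> ((Complex a b : R[i]) : R[i]^o))%classic.
  apply/cvgc_normcP.
  have ReE n : Re (series f n) = series (fun n => Re (f n)) n.
    by rewrite !seriesEord; exact: Re_sum.
  have ImE n : Im (series f n) = series (fun n => Im (f n)) n.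
    by rewrite !seriesEord; exact: Im_sum.
  have : (`|series (fun n => Re (f n)) n - a| + `|series (fun n => Im (f n)) n - b|
      @[n --> \oo] --> `|a - a| + `|b - b|)%classic.
    by apply: cvgD; apply: cvg_norm; apply: cvgB => //; exact: cvg_cst.
  rewrite !subrr normr0 addr0; apply: squeeze_cvgr; last exact: cvg_cst.
  near=> n; rewrite normc_ge0 /=; apply: le_trans (normc_le_ReIm _) _.
  by rewrite -ReE -ImE; case: (series f n).
exists (Complex a b) => //; apply: normc_lim_le HL _ => n.
rewrite seriesEord; apply: le_trans (fD n); exact: normc_sum_le.
Unshelve. all: by end_near.
Qed.

(** * Generalized binomial coefficients and their decay *)

Lemma binomC0 (z : R[i]) : binomC z 0 = 1.
Proof. by rewrite /binomC big_ord0 divr1. Qed.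

Lemma binomCS (z : R[i]) n : binomC z n.+1 = binomC z n * ((z - n%:R) / n.+1%:R).
Proof.
rewrite /binomC big_ord_recr /= factS natrM.
rewrite -!mulrA; congr (_ * _); rewrite invfM; ring.
Qed.

Lemma binomC_absorb (z : R[i]) n :
  (z + 1) * binomC z n = n.+1%:R * binomC (z + 1) n.+1.
Proof.
have nz : n.+1%:R != 0 :> R[i] by rewrite pnatr_eq0.
rewrite /binomC big_ord_recl /= subr0 factS natrM invfM.
have -> : \prod_(i < n) (z + 1 - (lift ord0 i)%:R) = \prod_(i < n) (z - i%:R).
  apply: eq_bigr => i _; rewrite /lift /= /bump /= add1n -natr1; ring.
have : (n`!)%:R != 0 :> R[i] by rewrite pnatr_eq0 -lt0n fact_gt0.
by move: nz; move: n.+1%:R (n`!)%:R => m f nz fz; field; rewrite nz fz.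
Qed.

Lemma binomC_pascal (z : R[i]) n :
  binomC (z + 1) n.+1 = binomC z n.+1 + binomC z n.
Proof.
have nz : n.+1%:R != 0 :> R[i] by rewrite pnatr_eq0.
apply: (mulfI nz); rewrite -binomC_absorb binomCS.
by move: nz; rewrite -natr1 => nz; field.
Qed.

Lemma binomC_nat N n : binomC (N%:R : R[i]) n = 'C(N, n)%:R.
Proof.
elim: N n => [|N IHN] [|n]; rewrite ?binomC0 ?bin0 //.
  rewrite bin0n /=; elim: n => [|n IHn].
    by rewrite binomCS binomC0 subr0 mul0r mulr0.
  by rewrite binomCS IHn mul0r.
by rewrite -natr1 binomC_pascal !IHN binS natrD.
Qed.

(** The squared modulus is 1 - 2 t Re w + t^2 |w|^2, to which 1 + x <= exp x applies. *)
Lemma normc_subM1 (w : R[i]) (t : R) :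
  normc (w * t%:C - 1) <=
    expR (- (Re w * t) + (Re w ^+ 2 + Im w ^+ 2) / 2 * t ^+ 2).
Proof.
case: w => a b /=.
rewrite -[leRHS]ger0_norm ?expR_ge0 // -sqrtr_sqr ler_wsqrtr //.
rewrite -expRM_natl; apply: le_trans (expR_ge1Dx _).
by rewrite le_eqVlt; apply/orP; left; apply/eqP; field.
Qed.

(* The quadratic error terms 1/(n+1)^2 are absorbed in the increments of
   2 (1 - 1/(n+1)). *)
Lemma normc_binomC_le (z : R[i]) : exists2 K : R, 0 <= K &
  forall n, normc (binomC z n) <= K * expR (- ((Re z + 1) * harm R n)).
Proof.
set s := Re z + 1; pose V := s ^+ 2 + Im z ^+ 2.
have V_ge0 : 0 <= V by rewrite addr_ge0 ?sqr_ge0.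
exists (expR (s + V)); first exact: expR_ge0.
suff H n : normc (binomC z n) <=
    expR (s + V * (1 - n.+1%:R^-1) - s * harm R n).
  move=> n; apply: le_trans (H n) _; rewrite -expRD ler_expR lerD2r lerD2l.
  by rewrite ler_piMr // gerBl invr_ge0.
elim: n => [|n IHn].
  rewrite binomC0 ComplexField.Normc.normc1 harm0 invr1 subrr mulr0 addr0.
  by rewrite mulr1 subrr expR0.
rewrite binomCS ComplexField.Normc.normcM harmS.
pose t : R := n.+1%:R^-1.
have t_gt0 : 0 < t by rewrite invr_gt0.
(* In this form [normc_subM1] applies with w = z + 1; the linear term of its exponent is -s times
   the increment of [harm]. *)
have -> : (z - n%:R) / n.+1%:R = (z + 1) * t%:C - 1 :> R[i].
  rewrite /t fmorphV rmorph_nat -[n.+1%:R]natr1; field.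
  by rewrite natr1 pnatr_eq0.
apply: le_trans (ler_pM _ _ IHn (normc_subM1 _ _)) _; rewrite ?normc_ge0 //.
rewrite -expRD ler_expR.
have -> : Re (z + 1) = s by rewrite /s; case: (z).
have -> : Im (z + 1) = Im z by case: (z) => a b /=; rewrite addr0.
rewrite -/V -/t.
have -> : n.+2%:R^-1 = t / (1 + t) :> R.
  have a_gt0 : 0 < n.+1%:R :> R by rewrite ltr0n.
  rewrite -[n.+2%:R]natr1 /t; move: (n.+1%:R) a_gt0 => a a_gt0; field.
  by rewrite !gt_eqF // addr_gt0.
suff: V / 2 * t ^+ 2 <= V * (t - t / (1 + t)) by lra.
have t_le1 : t <= 1 by rewrite invf_le1 // ler1n.
rewrite -mulrA ler_wpM2l //.
have -> : t - t / (1 + t) = t ^+ 2 / (1 + t).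
  by field; rewrite gt_eqF // addr_gt0.
rewrite mulrC ler_wpM2l ?sqr_ge0 // lef_pV2 ?posrE ?addr_gt0 //; lra.
Qed.

End ComplexSeries.

(** * Coefficients of the Newton series *)

Section Newton.
Variable R : realType.
Local Notation harm := (@harm R).
Implicit Types b u : nat -> R.

(** The sign is that of [nabla]: this is the sum over j of (-1)^j binom(N, j) b(n+j). *)
Fixpoint delta (N : nat) b (n : nat) : R :=
  if N is N'.+1 then delta N' b n - delta N' b n.+1 else b n.

Definition shrink u (n : nat) : R := u n / n.+1%:R.

Definition cesaro_mean u (n : nat) : R := (\sum_(i < n.+1) u i) / n.+1%:R.

Lemma deltaS N b n : delta N.+1 b n = delta N b n - delta N b n.+1.
Proof. by []. Qed.

Lemma cesaro0 u : cesaro_mean u 0 = u 0%N.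
Proof. by rewrite /cesaro_mean big_ord_recr big_ord0 /= add0r divr1. Qed.

Lemma cesaroS u n :
  n.+2%:R * cesaro_mean u n.+1 = n.+1%:R * cesaro_mean u n + u n.+1.
Proof.
rewrite /cesaro_mean big_ord_recr /= mulrC divfK ?pnatr_eq0 //.
by rewrite [n.+1%:R * _]mulrC divfK ?pnatr_eq0.
Qed.

(** Leibniz rule for the differences of (n+1) [shrink u n] = u n. It is a recurrence in [N] of the
    shape required by [slow_step], with m = n+N and c = N+1. *)
Lemma delta_shrink u N n :
  (n + N).+2%:R * delta N.+1 (shrink u) n =
  N.+1%:R * delta N (shrink u) n + delta N.+1 u n.
Proof.
elim: N n => [|N IHN] n.
  rewrite addn0 /= /shrink -[n.+2%:R]natr1.
  have : n.+1%:R + 1 != 0 :> R by rewrite natr1 pnatr_eq0.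
  have : n.+1%:R != 0 :> R by rewrite pnatr_eq0.
  by move: (n.+1%:R) => x x0 x1; field; rewrite x0 x1.
have := IHN n; have := IHN n.+1.
rewrite [delta N.+2 _ n]deltaS [delta N.+2 u n]deltaS.
have -> : delta N (shrink u) n.+1 = delta N (shrink u) n - delta N.+1 (shrink u) n.
  by rewrite deltaS subKr.
rewrite addnS addSn -[(n + N).+3%:R]natr1 -[N.+2%:R]natr1.
move: (delta N.+1 _ n.+1) (delta N.+1 _ n) (delta N _ n) => x y v.
move: (delta N.+1 u n) (delta N.+1 u n.+1) => p q; lra.
Qed.

(** The N-th difference of [cesaroS]. In contrast to [delta_shrink] this is a recurrence in [n] at
    fixed [N], started by [delta_cesaro0]. *)
Lemma delta_cesaroS u N n :
  (n.+1 + N).+1%:R * delta N (cesaro_mean u) n.+1 =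
  n.+1%:R * delta N (cesaro_mean u) n + delta N u n.+1.
Proof.
elim: N n => [|N IHN] n; first by rewrite addn0 cesaroS.
have := IHN n; have := IHN n.+1.
rewrite [delta N.+1 _ n.+1]deltaS [delta N.+1 u n.+1]deltaS.
rewrite [delta N.+1 _ n]deltaS.
rewrite !addnS !addSn -[(n + N).+3%:R]natr1 -[n.+2%:R]natr1.
set w := cesaro_mean u; move: (delta N w n.+2) (delta N w n.+1) (delta N w n).
move=> x y v; move: (delta N u n.+1) (delta N u n.+2) => p q; lra.
Qed.

Lemma delta_cesaro0 u N : N.+1%:R * delta N (cesaro_mean u) 0 = delta N u 0.
Proof.
elim: N => [|N IHN]; first by rewrite /= cesaro0 mul1r.
have := delta_cesaroS u N 0; rewrite !deltaS -IHN add1n mul1r -[N.+2%:R]natr1.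
move: (delta N (cesaro_mean u) 1) (delta N (cesaro_mean u) 0) (delta N u 1) => x y v; lra.
Qed.

(** The bound depends on n+N alone, so it propagates along a recurrence in either variable; the
    exponent [k] counts logarithms. *)
Definition slow k b := forall N n,
  `|delta N b n| <= harm (n + N) ^+ k / (n + N).+1%:R.

Lemma harm_pow_step k n :
  harm n ^+ k.+1 + harm n.+1 ^+ k / n.+2%:R <= harm n.+1 ^+ k.+1.
Proof.
have h0 := harm_ge0 R n; have h1 := harm_ge0 R n.+1.
have le1 : harm n ^+ k.+1 <= harm n.+1 ^+ k * harm n.
  rewrite exprSr ler_wpM2r // lerXn2r ?nnegrE //.
  exact: harm_le.
apply: le_trans (lerD le1 (lexx _)) _; rewrite -mulrDr exprSr.
rewrite ler_wpM2l ?exprn_ge0 // harmS lerD2l lef_pV2 ?posrE ?ltr0n //.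
by rewrite ler_nat.
Qed.

Lemma harm_pow_div_le k n : harm n ^+ k / n.+1%:R <= harm n ^+ k.+1.
Proof.
rewrite exprSr ler_wpM2l ?exprn_ge0 ?harm_ge0 //.
by apply: le_trans (harm_ge1 R n); rewrite invf_le1 // ler1n.
Qed.

(* A recurrence (m+1) w_m = c w_(m-1) + v_m with 0 <= c <= m costs one
   logarithm: the products (m+1) |w_m| then grow by at most |v_m|. *)
Lemma slow_step k m (c x y v : R) : 0 <= c <= m.+1%:R ->
  m.+2%:R * x = c * y + v ->
  `|y| <= harm m ^+ k.+1 / m.+1%:R ->
  `|v| <= harm m.+1 ^+ k / m.+2%:R ->
  `|x| <= harm m.+1 ^+ k.+1 / m.+2%:R.
Proof.
move=> /andP[c_ge0 c_le] eq_x y_le v_le.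
rewrite ler_pdivlMr // mulrC -[X in X * _]ger0_norm // -normrM eq_x.
apply: le_trans (ler_normD _ _) _; apply: le_trans (harm_pow_step k m).
apply: lerD => //; rewrite normrM ger0_norm //.
apply: le_trans (ler_wpM2l c_ge0 y_le) _.
rewrite mulrCA ler_piMr ?exprn_ge0 ?harm_ge0 //.
by rewrite ler_pdivrMr // mul1r.
Qed.

Lemma slow_shrink k u : slow k u -> slow k.+1 (shrink u).
Proof.
move=> su; elim=> [|N IHN] n.
  rewrite addn0 /= normrM normfV normr_nat ler_wpM2r ?invr_ge0 //.
  have := su 0%N n; rewrite addn0 /= => /le_trans; apply.
  exact: harm_pow_div_le.
rewrite addnS; have := su N.+1 n; rewrite addnS => su1.
apply: slow_step (delta_shrink u N n) (IHN n) su1.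
by rewrite ler0n ler_nat ltnS leq_addl.
Qed.

Lemma slow_cesaro k u : slow k u -> slow k.+1 (cesaro_mean u).
Proof.
move=> su N; elim=> [|n IHn].
  rewrite add0n.
  have -> : delta N (cesaro_mean u) 0 = delta N u 0 / N.+1%:R.
    by rewrite -(delta_cesaro0 u) [_ * delta _ _ _]mulrC mulfK ?pnatr_eq0.
  rewrite normrM normfV normr_nat ler_wpM2r ?invr_ge0 //.
  have := su N 0%N; rewrite add0n /= => /le_trans; apply.
  exact: harm_pow_div_le.
have := su N n.+1; rewrite addSn => su1.
have := delta_cesaroS u N n; rewrite addSn => ceq.
by apply: slow_step ceq IHn su1; rewrite ler0n ler_nat ltnS leq_addr.
Qed.

(** The constant 1 does not decay, but its differences vanish. Hence the recurrence [delta_shrink]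
    is homogeneous here and costs no logarithm. *)
Lemma slow_shrink1 : slow 0 (shrink (fun=> 1)).
Proof.
have delta1 N n : delta N.+1 (fun=> 1) n = 0.
  by elim: N n => [|N IHN] n; rewrite deltaS ?subrr // !IHN subrr.
elim=> [|N IHN] n.
  by rewrite addn0 /= normrM normr1 ger0_norm ?invr_ge0.
have := delta_shrink (fun=> 1) N n; rewrite delta1 addr0 => eq_d.
rewrite addnS expr0 ler_pdivlMr // mulrC -[X in X * _]ger0_norm // -normrM eq_d.
rewrite normrM ger0_norm //.
apply: le_trans (ler_wpM2l (ler0n _ _) (IHN n)) _.
by rewrite expr0 mul1r ler_pdivrMr // mul1r ler_nat ltnS leq_addl.
Qed.

(* Indices are listed from the outermost summation variable, so the head of
   [s] is the last entry of the multi-index. *)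
Fixpoint newton_coef (s : seq nat) : nat -> R :=
  if s is a :: s' then iter a.-1 cesaro_mean (shrink (newton_coef s')) else fun=> 1.

Lemma slow_iter_cesaro k j u : slow k u -> slow (j + k) (iter j cesaro_mean u).
Proof. by move=> su; elim: j => //= j; exact: slow_cesaro. Qed.

Lemma slow_newton_coef a s : exists k, slow k (newton_coef (a :: s)).
Proof.
elim: s a => [|a' s IHs] a.
  by exists (a.-1 + 0)%N; apply: slow_iter_cesaro; exact: slow_shrink1.
have [k sk] := IHs a'.
by exists (a.-1 + k.+1)%N; apply: slow_iter_cesaro; exact: slow_shrink.
Qed.

End Newton.

(** * Newton series *)

Lemma series_ordE (V : zmodType) (f : nat -> V) n :
  series f n = \sum_(k < n) f k.
Proof. by rewrite seriesEord. Qed.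

Section NewtonFunction.
Variable R : realType.
Local Open Scope complex_scope.
Local Notation normc := (@complex.ComplexField.Normc.normc R).
Local Notation Re := complex.Re.
Local Notation harm := (@harm R).
Implicit Types (b u : nat -> R) (z : R[i]).

(** The value d = 1 serves for the functions F_s, and d = 0 for their increments from z to z+1, by
    Pascal's rule. *)
Definition newton_term d b z (n : nat) : R[i]^o :=
  (-1) ^+ n * (b n)%:C * binomC z (d + n).

Definition newton d b z : R[i] :=
  limn (series (newton_term d b z) : nat -> R[i]^o).

(** Unlike [slow], this concerns a single sequence and allows a constant. It suffices for absolute
    convergence on Re z > -1, where [normc_binomC_le] supplies exp(-(Re z + 1) [harm n]). *)
Definition decays b := exists C k, forall n,
  `|b n| <= C * (harm n ^+ k / n.+1%:R).

Lemma normc_newton_term d b z n :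
  normc (newton_term d b z n) = `|b n| * normc (binomC z (d + n)).
Proof.
by rewrite /newton_term !ComplexField.Normc.normcM normcX_sign mul1r normc_real.
Qed.

Lemma sum_newton_term d b z : decays b -> -1 < Re z ->
  exists D, forall M, \sum_(n < M) normc (newton_term d b z n) <= D.
Proof.
move=> [C [k bC]] hz; have s_gt0 : 0 < Re z + 1 by lra.
have C_ge0 : 0 <= C.
  by have := le_trans (normr_ge0 _) (bC 0%N); rewrite harm0 expr1n divr1 mulr1.
have [K K_ge0 HK] := normc_binomC_le z.
have [D HD] := sum_harm_pow_expR k s_gt0.
exists (C * K * D) => M; apply: le_trans (ler_wpM2l (mulr_ge0 C_ge0 K_ge0) (HD M)).
rewrite mulr_sumr ler_sum // => n _; rewrite normc_newton_term.
have le_K : normc (binomC z (d + n)) <= K * expR (- ((Re z + 1) * harm n)).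
  apply: le_trans (HK _) _; rewrite ler_wpM2l // ler_expR lerN2.
  by rewrite ler_wpM2l ?(ltW s_gt0) // harm_le // leq_addl.
apply: le_trans (ler_pM _ _ (bC n) le_K) _; rewrite ?normc_ge0 //.
by rewrite le_eqVlt; apply/orP; left; apply/eqP; ring.
Qed.

Lemma newton_cvg d b z : decays b -> -1 < Re z ->
  (series (newton_term d b z) @ \oo --> (newton d b z : R[i]^o))%classic.
Proof.
move=> db hz; have [D HD] := sum_newton_term d db hz.
by have [L HL _] := complex_series_cvg HD; rewrite /newton (cvg_lim _ HL).
Qed.

Lemma normc_newton_le d b z D : decays b -> -1 < Re z ->
  (forall M, \sum_(n < M) normc (newton_term d b z n) <= D) ->
  normc (newton d b z) <= D.
Proof.
move=> db hz HD; apply: (normc_lim_le (newton_cvg (d := d) db hz)) => n.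
by rewrite series_ordE; apply: le_trans (HD n); exact: normc_sum_le.
Qed.

Lemma newton_eq d b z (L : R[i]) :
  (series (newton_term d b z) @ \oo --> (L : R[i]^o))%classic -> newton d b z = L.
Proof. by move=> HL; rewrite /newton (cvg_lim _ HL). Qed.

Lemma newtonS1 b z : decays b -> -1 < Re z ->
  newton 1 b (z + 1) = newton 1 b z + newton 0 b z.
Proof.
move=> db hz; apply: newton_eq.
have -> : series (newton_term 1 b (z + 1)) =
    (fun n => series (newton_term 1 b z) n + series (newton_term 0 b z) n).
  apply/funext => n; rewrite !series_ordE -big_split; apply: eq_bigr => i _ /=.
  by rewrite /newton_term add1n add0n binomC_pascal mulrDr.
by apply: cvgD; exact: newton_cvg.
Qed.

Lemma newton0_shift b z : decays b -> -1 < Re z ->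
  (series (newton_term 1 (fun n => b n.+1) z) @ \oo -->
    ((b 0%N)%:C - newton 0 b z : R[i]^o))%classic.
Proof.
move=> db hz.
have -> : series (newton_term 1 (fun n => b n.+1) z) =
    (fun n => (b 0%N)%:C - series (newton_term 0 b z) n.+1 : R[i]^o).
  apply/funext => n; rewrite !series_ordE. rewrite big_ord_recl.
  rewrite {2}/newton_term binomC0 mulr1 mul1r opprD addrA subrr add0r -sumrN.
  apply: eq_bigr => i _; rewrite /newton_term /= /bump /= !add1n add0n exprS.
  by rewrite !mulN1r mulNr mulNr opprK.
apply: cvgB; first exact: cvg_cst.
by rewrite (cvg_shiftS (series (newton_term 0 b z) : nat -> R[i]^o)); exact: newton_cvg.
Qed.

(** Translating z by 1 replaces the coefficients by their differences, up to an additive constant.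
    The constants do not depend on z, so they cancel in F_s(z+N) - F_s(N). *)
Lemma newton1_shift b z : decays b -> -1 < Re z ->
  newton 1 b (z + 1) = (b 0%N)%:C + newton 1 (delta 1 b) z.
Proof.
move=> db hz; rewrite newtonS1 //.
suff -> : newton 1 (delta 1 b) z =
    newton 1 b z - ((b 0%N)%:C - newton 0 b z) by ring.
apply: newton_eq.
have -> : series (newton_term 1 (delta 1 b) z) = (fun n =>
    series (newton_term 1 b z) n - series (newton_term 1 (fun n => b n.+1) z) n).
  apply/funext => n; rewrite !series_ordE -sumrB; apply: eq_bigr => i _ /=.
  by rewrite /newton_term /= rmorphB mulrBr mulrBl.
by apply: cvgB; [exact: newton_cvg|exact: newton0_shift].
Qed.

(** By absorption, (z+1) binom(z, i) = (i+1) binom(z+1, i+1), and i+1 cancels the division in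
    [shrink]. *)
Lemma newton_term_shrink u z i :
  newton_term 1 u (z + 1) i = (z + 1) * newton_term 0 (shrink u) z i :> R[i].
Proof.
rewrite /newton_term add1n add0n [RHS]mulrCA binomC_absorb /shrink rmorphM fmorphV.
rewrite rmorph_nat [RHS]mulrA; congr (_ * _).
by rewrite -mulrA divfK ?pnatr_eq0.
Qed.

Lemma newton_shrink u z :
  decays (shrink u) -> -1 < Re z ->
  (series (newton_term 1 u (z + 1)) @ \oo -->
    ((z + 1) * newton 0 (shrink u) z : R[i]^o))%classic.
Proof.
move=> du hz.
have -> : series (newton_term 1 u (z + 1)) =
    (fun n => (z + 1) * series (newton_term 0 (shrink u) z) n : R[i]^o).
  apply/funext => n; rewrite !series_ordE mulr_sumr; apply: eq_bigr => i _ /=.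
  exact: newton_term_shrink.
by apply: cvgMr; exact: newton_cvg.
Qed.

(** The factor n+1 uses up the decay of [b] except for logarithms, and these are beaten by the
    binomial coefficient because Re z + 1 > 0. This is the boundary term of [newton_sum_cesaro]. *)
Lemma boundary_cvg0 b z : decays b -> -1 < Re z ->
  (n.+1%:R * (-1) ^+ n * (b n)%:C * binomC z n.+1 @[n --> \oo] -->
    (0 : R[i]^o))%classic.
Proof.
move=> [C [k bC]] hz; have s_gt0 : 0 < Re z + 1 by lra.
apply/cvgc_normcP.
have [K K_ge0 HK] := normc_binomC_le z.
have : (C * K * (harm n ^+ k * expR (- ((Re z + 1) * harm n)))
    @[n --> \oo] --> (C * K * 0 : R))%classic.
  by apply: cvgMr; exact: harm_pow_expR_cvg0.
rewrite mulr0; apply: squeeze_cvgr; last exact: cvg_cst.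
near=> n; rewrite normc_ge0 /= subr0 3!ComplexField.Normc.normcM normcX_sign mulr1.
have -> : normc n.+1%:R = n.+1%:R 
  by rewrite -(rmorph_nat (real_complex R)) normc_real normr_nat.
rewrite normc_real.
have le_K : normc (binomC z n.+1) <= K * expR (- ((Re z + 1) * harm n)).
  apply: le_trans (HK _) _; rewrite ler_wpM2l // ler_expR lerN2.
  by rewrite ler_wpM2l ?(ltW s_gt0) // harm_le.
have le_C : n.+1%:R * `|b n| <= C * harm n ^+ k.
  apply: le_trans (ler_wpM2l (ler0n _ _) (bC n)) _.
  by rewrite [leLHS]mulrC -mulrA divfK ?pnatr_eq0.
apply: le_trans (ler_pM _ _ le_C le_K) _; rewrite ?normc_ge0 ?mulr_ge0 //.
by rewrite le_eqVlt; apply/orP; left; apply/eqP; ring.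
Unshelve. all: by end_near.
Qed.

(** Summation by parts, with u(n) expressed through two consecutive Cesaro means. *)
Lemma newton_sum_cesaro u z n :
  \sum_(k < n.+1) (newton_term 0 u z k : R[i]) =
  (z + 1) * \sum_(k < n.+1) (newton_term 0 (cesaro_mean u) z k : R[i]) -
  n.+1%:R * (-1) ^+ n * (cesaro_mean u n)%:C * binomC z n.+1.
Proof.
elim: n => [|n IHn].
  rewrite !big_ord_recl !big_ord0 !addr0 /newton_term /= binomC0.
  by rewrite binomCS binomC0 cesaro0 subr0 divr1; ring.
rewrite big_ord_recr IHn [in RHS]big_ord_recr /=.
set w := cesaro_mean u; rewrite /newton_term !add0n [binomC z n.+2]binomCS.
have -> : (u n.+1)%:C = n.+2%:R * (w n.+1)%:C - n.+1%:R * (w n)%:C :> R[i].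
  rewrite -!(rmorph_nat (real_complex R)) -!rmorphM cesaroS rmorphD.
  by rewrite addrAC subrr add0r.
have : n.+2%:R != 0 :> R[i] by rewrite pnatr_eq0.
rewrite exprS -[n.+2%:R]natr1; move: (n.+1%:R : R[i]) => x x0.
move: (w n)%:C (w n.+1)%:C (binomC z n.+1) => y v t.
by move: (\sum_(_ < _) _) => S; field.
Qed.

Lemma newton_cesaro u z : decays (cesaro_mean u) -> -1 < Re z ->
  (series (newton_term 0 u z) @ \oo -->
    ((z + 1) * newton 0 (cesaro_mean u) z : R[i]^o))%classic.
Proof.
move=> dw hz; set w := cesaro_mean u.
rewrite -(cvg_shiftS (series (newton_term 0 u z) : nat -> R[i]^o)).
have -> : (fun n => series (newton_term 0 u z) n.+1) = (fun n =>
    (z + 1) * series (newton_term 0 w z) n.+1 -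
    n.+1%:R * (-1) ^+ n * (w n)%:C * binomC z n.+1 : R[i]^o).
  by apply/funext => n; rewrite !series_ordE; exact: newton_sum_cesaro.
have Hw : (series (newton_term 0 w z) n.+1 @[n --> \oo] -->
    (newton 0 w z : R[i]^o))%classic.
  rewrite (cvg_shiftS (series (newton_term 0 w z) : nat -> R[i]^o)).
  exact: newton_cvg.
have Hz : ((z + 1) * series (newton_term 0 w z) n.+1 @[n --> \oo] -->
    ((z + 1) * newton 0 w z : R[i]^o))%classic by exact: cvgMr.
suff : (((fun n => (z + 1) * series (newton_term 0 w z) n.+1 : R[i]^o) -
    (fun n => n.+1%:R * (-1) ^+ n * (w n)%:C * binomC z n.+1 : R[i]^o))
    @ \oo --> ((z + 1) * newton 0 w z - 0 : R[i]^o))%classic by rewrite subr0.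
by apply: cvgB; [exact: Hz|exact: boundary_cvg0].
Qed.

End NewtonFunction.

(** * The functions [F_s] *)

Section Kawashima.
Variable R : realType.
Local Open Scope complex_scope.
Local Notation normc := (@complex.ComplexField.Normc.normc R).
Local Notation Re := complex.Re.
Local Notation harm := (@harm R).
Implicit Types (b u : nat -> R) (z : R[i]).

Lemma Re_addn z N : Re (z + N%:R) = Re z + N%:R.
Proof. by rewrite -(rmorph_nat (real_complex R)); case: z. Qed.

Lemma Re_add1 z : Re (z + 1) = Re z + 1.
Proof. exact: Re_addn z 1. Qed.

Lemma harm_shift_le k (n N : nat) : harm (n + N) ^+ k / (n + N).+1%:R <=
  (2 * harm N) ^+ k * (harm n ^+ k / (n + N).+1%:R).
Proof.
rewrite mulrA ler_wpM2r ?invr_ge0 // -exprMn lerXn2r ?nnegrE ?harm_ge0 //.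
  by rewrite !mulr_ge0 ?harm_ge0.
by rewrite addnC [_ * harm n]mulrAC -mulrAC harmD_leM.
Qed.

Lemma decays_delta k b N : slow k b -> decays (delta N b).
Proof.
move=> sb; exists ((2 * harm N) ^+ k), k => n.
apply: le_trans (sb N n) _; apply: le_trans (harm_shift_le _ _ _) _.
rewrite ler_wpM2l ?exprn_ge0 ?mulr_ge0 ?harm_ge0 //.
rewrite ler_wpM2l ?exprn_ge0 ?harm_ge0 //.
by rewrite lef_pV2 ?posrE ?ltr0n // ler_nat ltnS leq_addr.
Qed.

Lemma slow_decays k b : slow k b -> decays b.
Proof. exact: (@decays_delta _ _ 0). Qed.

Lemma newton_iter_cesaro k j u z : slow k u -> -1 < Re z ->
  (z + 1) ^+ j * newton 0 (iter j (@cesaro_mean R) u) z = newton 0 u z.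
Proof.
move=> su hz; elim: j => [|j IHj]; first by rewrite mul1r.
rewrite -IHj exprSr -mulrA; congr (_ * _); apply/esym/newton_eq.
by apply: newton_cesaro => //; apply: slow_decays (slow_iter_cesaro j.+1 su).
Qed.

(** The empty list is set apart because a series [newton 1 b] vanishes at 0, whereas the empty
    product must be 1 there. *)
Definition kfun (s : seq nat) z : R[i] :=
  if s is [::] then 1 else newton 1 (newton_coef R s) z.

Lemma newton_shrink_const z : -1 < Re z ->
  (z + 1) * newton 0 (shrink (fun=> 1)) z = 1.
Proof.
(* The sequence 1, 0, 0, ... has the Cesaro means 1/(n+1), and its Newton series is the constant
   1. *)
move=> hz; pose e n : R := (n == 0%N)%:R.
have shrinkE : shrink (fun=> 1) = cesaro_mean e.
  apply/funext => n; rewrite /shrink /cesaro_mean big_ord_recl /= big1 ?addr0 //.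
rewrite shrinkE -(newton_eq (newton_cesaro _ hz)); last first.
  by rewrite -shrinkE; apply: slow_decays (@slow_shrink1 R).
apply: newton_eq.
rewrite -(cvg_shiftS (series (newton_term 0 e z) : nat -> R[i]^o)).
have -> : (fun n => series (newton_term 0 e z) n.+1) = (fun=> 1 : R[i]^o).
  apply/funext => n; rewrite series_ordE big_ord_recl big1 ?addr0.
    by rewrite /newton_term binomC0 !mulr1.
  by move=> i _; rewrite /newton_term /= mulr0 mul0r.
exact: cvg_cst.
Qed.

Lemma newton_shrink_coef s z : -1 < Re z ->
  (z + 1) * newton 0 (shrink (newton_coef R s)) z = kfun s (z + 1).
Proof.
case: s => [|a s] hz; first exact: newton_shrink_const.
have [k sk] := slow_newton_coef R a s.
by apply/esym/newton_eq/newton_shrink => //; apply: slow_decays (slow_shrink sk).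
Qed.

Lemma z1_neq0 z : -1 < Re z -> z + 1 != 0.
Proof.
move=> hz; apply/eqP => /(congr1 (@complex.Re R)); rewrite Re_add1 /= => h; lra.
Qed.

(** The increment is the series [newton 0] of the coefficients. Each of the a-1 Cesaro means divides
    it by z+1, and [shrink] supplies the last factor. *)
Lemma kfunS a s z : (0 < a)%N -> -1 < Re z ->
  kfun (a :: s) (z + 1) = kfun (a :: s) z + kfun s (z + 1) / (z + 1) ^+ a.
Proof.
move=> a_gt0 hz; have [k sk] := slow_newton_coef R a s.
have z1 := z1_neq0 hz.
rewrite /kfun newtonS1 -/(kfun s (z + 1)) //; last exact: slow_decays sk.
congr (_ + _); rewrite -newton_shrink_coef //.
have [k' sk'] : exists k', slow k' (shrink (newton_coef R s)).
  case: (s) => [|a' s']; first by exists 0%N; exact: slow_shrink1.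
  by have [k' sk'] := slow_newton_coef R a' s'; exists k'.+1; exact: slow_shrink.
rewrite -(newton_iter_cesaro a.-1 sk' hz) mulrA -exprS prednK //.
by rewrite mulrC mulKf // expf_neq0.
Qed.

Lemma newton1_at0 b : newton 1 b 0 = 0.
Proof.
apply: newton_eq; have -> : series (newton_term 1 b 0) = (fun=> 0 : R[i]^o).
  apply/funext => n; rewrite series_ordE big1 // => i _.
  by rewrite /newton_term -[0]/(0%:R) binomC_nat add1n bin0n mulr0.
exact: cvg_cst.
Qed.

Lemma kfun_at0 a s : kfun (a :: s) 0 = 0.
Proof. exact: newton1_at0. Qed.

Lemma newton_shiftn k b z N : slow k b -> -1 < Re z ->
  newton 1 b (z + N%:R) =
  \sum_(j < N) (delta j b 0)%:C + newton 1 (delta N b) z.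
Proof.
move=> sb; elim: N z => [|N IHN] z hz; first by rewrite addr0 big_ord0 add0r.
have hz1 : -1 < Re (z + 1) by rewrite Re_add1; lra.
rewrite -natr1 [N%:R + 1]addrC addrA IHN //.
rewrite newton1_shift //; last exact: decays_delta sb.
by rewrite big_ord_recr /= addrA.
Qed.

(* For [Re z >= 1] the terms of the shifted series are at most
   [harm n ^+ k * expR (- harm n) / n.+1], uniformly in the shift, up to the
   decaying factor [harm N ^+ k / N.+1]. *)
Lemma kfun_shift s z : 1 <= Re z -> exists D k, forall N,
  normc (kfun s (z + N%:R) - kfun s N%:R) <= D * (harm N ^+ k / N.+1%:R).
Proof.
move=> hz; case: s => [|a s].
  by exists 0, 0%N => N; rewrite subrr ComplexField.Normc.normc0 mul0r.
have [k sk] := slow_newton_coef R a s; rewrite /kfun.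
set b := newton_coef R (a :: s) in sk *.
have hz' : -1 < Re z by lra.
have [K K_ge0 HK] := normc_binomC_le z.
have [D HD] := sum_harm_pow_expR k (@ltr01 R).
exists (2 ^+ k * (K * D)), k => N.
have h0 : -1 < Re (0 : R[i]) by rewrite /= ltrN10.
rewrite (newton_shiftn N sk hz') -[X in newton 1 b X]add0r (newton_shiftn N sk h0).
rewrite newton1_at0 addr0 addrAC subrr add0r.
apply: normc_newton_le => //; first exact: decays_delta sk.
move=> M.
have -> : 2 ^+ k * (K * D) * (harm N ^+ k / N.+1%:R) =
  ((2 * harm N) ^+ k / N.+1%:R * K) * D by rewrite exprMn; ring.
apply: le_trans (ler_wpM2l _ (HD M)); last first.
  by rewrite mulr_ge0 // divr_ge0 // exprn_ge0 // mulr_ge0 // harm_ge0.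
rewrite mulr_sumr ler_sum // => n _; rewrite normc_newton_term.
have le_b : `|delta N b n| <= (2 * harm N) ^+ k / N.+1%:R * harm n ^+ k.
  apply: le_trans (sk N n) _; apply: le_trans (harm_shift_le _ _ _) _.
  rewrite -[leRHS]mulrA ler_wpM2l ?exprn_ge0 ?mulr_ge0 ?harm_ge0 //.
  rewrite [leRHS]mulrC ler_wpM2l ?exprn_ge0 ?harm_ge0 //.
  by rewrite lef_pV2 ?posrE ?ltr0n // ler_nat ltnS leq_addl.
have le_binom : normc (binomC z (1 + n)) <= K * (expR (- (1 * harm n)) / n.+1%:R).
  apply: le_trans (HK _) _; rewrite ler_wpM2l // mul1r.
  (* The coefficient bound has spent its denominator on 1/(N+1). Since Re z + 1 >= 2, the binomial
     coefficient offers two exponentials: one yields 1/(n+1), the other makes the sum over n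
     bounded. *)
  apply: (@le_trans _ _ (expR (- harm n) * expR (- harm n))).
    rewrite -expRD ler_expR -opprD lerN2.
    have h1 : harm n <= harm (1 + n) by rewrite harm_le // leq_addl.
    by have := harm_ge0 R n; nra.
  rewrite ler_wpM2l ?expR_ge0 // expRN lef_pV2 ?posrE ?expR_gt0 //.
  exact: expR_harm_ge.
apply: le_trans (ler_pM _ _ le_b le_binom) _; rewrite ?normc_ge0 //.
by rewrite le_eqVlt; apply/orP; left; apply/eqP; ring.
Qed.

(** At natural numbers [kfunS] telescopes, and each entry of [s] contributes at most one harmonic
    sum, its exponent being at least 1. *)
Lemma normc_kfun_nat s N : all (leq 1) s -> normc (kfun s N%:R) <= harm N ^+ size s.
Proof.
elim: s N => [|a s IHs] N.
  by rewrite /kfun ComplexField.Normc.normc1 expr0.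
rewrite [all _ _]/= [size _]/= => /andP[a_gt0 s_gt0]; elim: N => [|N IHN].
  by rewrite kfun_at0 ComplexField.Normc.normc0 exprn_ge0 // harm_ge0.
rewrite -natr1 kfunS //; last first.
  by rewrite -(rmorph_nat (real_complex R)) /=; apply: lt_le_trans (ler0n _ _).
apply: le_trans (normcD_le _ _) _; rewrite natr1.
have le1 : normc (kfun s N.+1%:R / N.+1%:R ^+ a) <= harm N.+1 ^+ size s / N.+1%:R.
  rewrite ComplexField.Normc.normcM; apply: ler_pM; rewrite ?normc_ge0 ?IHs //.
  rewrite -(rmorph_nat (real_complex R)) -rmorphXn -fmorphV.
  rewrite normc_real normfV normrX normr_nat.
  rewrite lef_pV2 ?posrE ?exprn_gt0 ?ltr0n // -{1}(prednK a_gt0) exprS.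
  by rewrite ler_peMr // exprn_ege1 // ler1n.
apply: le_trans (lerD IHN le1) _.
have h0 := harm_ge0 R N; have h1 := harm_ge0 R N.+1.
have le2 : harm N ^+ size s * harm N <= harm N.+1 ^+ size s * harm N.
  by rewrite ler_wpM2r // lerXn2r ?nnegrE // harm_le.
have := lerD le2 (lexx (harm N.+1 ^+ size s / N.+1%:R)).
by rewrite -mulrDr -harmS -!exprSr.
Qed.

End Kawashima.

(** * Quasi-shuffles as lists of columns *)

Section QuasiShuffle.

(** The branches choose the first column: an entry of [s], an entry of [t], or both merged. The
    inner [fix] is there because the second branch shortens only [t]. *)
Fixpoint quasi_shuffle_cols (s t : seq nat) : seq (seq (nat * nat)) :=
  if s is a :: s' then
    (fix aux t := if t is b :: t' then
        [seq (a, 0%N) :: c | c <- quasi_shuffle_cols s' t] ++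
        [seq (0%N, b) :: c | c <- aux t'] ++
        [seq (a, b) :: c | c <- quasi_shuffle_cols s' t']
      else [:: [seq (x, 0%N) | x <- s]]) t
  else [:: [seq (0%N, x) | x <- t]].

Local Notation qs := quasi_shuffle_cols.

Definition col_sums (c : seq (nat * nat)) : seq nat := [seq (x.1 + x.2)%N | x <- c].

Lemma quasi_shuffle_nil s : qs s [::] = [:: [seq (x, 0%N) | x <- s]].
Proof. by case: s. Qed.

Lemma quasi_shuffle_cons a s b t : qs (a :: s) (b :: t) =
  [seq (a, 0%N) :: c | c <- qs s (b :: t)] ++
  [seq (0%N, b) :: c | c <- qs (a :: s) t] ++
  [seq (a, b) :: c | c <- qs s t].
Proof. by []. Qed.

Definition first_row (c : seq (nat * nat)) := [seq m <- [seq x.1 | x <- c] | m != 0%N].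
Definition second_row (c : seq (nat * nat)) := [seq m <- [seq x.2 | x <- c] | m != 0%N].
Definition nonzero_cols (c : seq (nat * nat)) := all (fun x => 0 < x.1 + x.2)%N c.

Lemma mem_map_cons (x y : nat * nat) c (l : seq (seq (nat * nat))) :
  (x :: c \in [seq y :: d | d <- l]) = (x == y) && (c \in l).
Proof.
apply/mapP/andP => [[d dl [-> ->]]|[/eqP -> cl]]; first by rewrite eqxx.
by exists c.
Qed.

(** Induction on the columns. As the entries of [s] and [t] are positive, the zeros of the first
    column tell which branch of the recursion can produce it. *)
Lemma mem_quasi_shuffle s t c : all (leq 1) s -> all (leq 1) t ->
  (c \in qs s t) = [&& first_row c == s, second_row c == t & nonzero_cols c].
Proof.
elim: c s t => [|[x y] c IHc] s t s_gt0 t_gt0.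
  rewrite /first_row /second_row /= andbT; case: s s_gt0 t_gt0 => [|a s] s_gt0.
    by rewrite inE; case: t.
  case: t => [|b t] t_gt0; first by rewrite inE.
  rewrite quasi_shuffle_cons !mem_cat.
  by apply/negP => /or3P[] /mapP[].
have close b1 b2 b3 b4 : [&& b1, b2, b3 & b4] = [&& b2, b1 && b3 & b4].
  by case: b1; rewrite // andbF.
case: s s_gt0 => [|[//|a] s] s_gt0.
  rewrite inE; case: t t_gt0 => [|[//|b] t] t_gt0.
    rewrite /= /first_row /second_row /nonzero_cols /=.
    by case: x y => [|x] [|y] //=; rewrite ?andbF.
  rewrite [_ == _]/= eqseq_cons xpair_eqE.
  have := IHc [::] t isT; rewrite inE => -> //.
  rewrite /first_row /second_row /nonzero_cols; case: x y => [|x] [|y] /=;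
    rewrite ?andbF //.
case: t t_gt0 => [|[//|b] t] t_gt0.
  rewrite quasi_shuffle_nil inE [_ == _]/= eqseq_cons xpair_eqE.
  have := IHc s [::]; rewrite quasi_shuffle_nil inE => -> //.
  rewrite /first_row /second_row /nonzero_cols; case: x y => [|x] [|y] /=;
    rewrite ?andbF //.
  by rewrite eqseq_cons andbT andbA.
have /andP[_ s_gt0'] := s_gt0; have /andP[_ t_gt0'] := t_gt0.
rewrite quasi_shuffle_cons !mem_cat !mem_map_cons !xpair_eqE !IHc //.
rewrite /first_row /second_row /nonzero_cols; case: x y => [|x] [|y] /=.
- by rewrite !andbF.
- by rewrite orbF eqseq_cons close.
- by rewrite eqxx andbT andbF orbF eqseq_cons andbA.
- rewrite andbF !eqseq_cons.
  by case: (x.+1 == a.+1); case: (y.+1 == b.+1); rewrite //= ?andbF.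
Qed.

Lemma uniq_quasi_shuffle s t : all (leq 1) s -> all (leq 1) t -> uniq (qs s t).
Proof.
elim: s t => [|a s IHs] t //= /andP[a_gt0 s_gt0].
elim: t => [|b t IHt] //= /andP[b_gt0 t_gt0].
have inj y : injective (cons y : seq (nat * nat) -> _) by move=> ? ? [].
rewrite -/(qs (a :: s) t) !cat_uniq !map_inj_uniq // IHt // !IHs //=; last first.
  by rewrite b_gt0.
rewrite andbT; apply/andP; split; last first.
  apply/hasPn => _ /mapP[c _ ->]; rewrite mem_map_cons xpair_eqE.
  by rewrite (gtn_eqF a_gt0).
apply/hasPn => d; rewrite mem_cat => /orP[] /mapP[c _ ->]; rewrite mem_map_cons xpair_eqE.
  by rewrite (gtn_eqF b_gt0) andbF.
by rewrite (gtn_eqF b_gt0) andbF.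
Qed.

(** Ensures that the truncated subtraction in the sign of [qs_sum] is a genuine one. *)
Lemma size_quasi_shuffle s t c : c \in qs s t -> (size c <= size s + size t)%N.
Proof.
elim: s t c => [|a s IHs] t c.
  by rewrite inE => /eqP ->; rewrite size_map.
elim: t c => [|b t IHt] c.
  by rewrite inE => /eqP ->; rewrite size_map addn0.
rewrite quasi_shuffle_cons !mem_cat => /or3P[] /mapP[d hd ->] /=.
- by rewrite ltnS (IHs (b :: t)).
- by rewrite addnS ltnS (IHt _ hd).
- by rewrite addnS addSn ltnS ltnW // ltnS IHs.
Qed.

End QuasiShuffle.

(** * The product formula for [F_s F_t] *)

Section Product.
Variable R : realType.
Local Open Scope complex_scope.
Local Notation normc := (@complex.ComplexField.Normc.normc R).
Local Notation Re := complex.Re.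
Local Notation harm := (@harm R).
Local Notation qs := quasi_shuffle_cols.
Implicit Types (f g : R[i] -> R[i]) (z : R[i]).

(** The range Re z >= 1 is that of [kfun_shift]; [periodic_eq0] reaches Re z > -1 by translating by
    2. *)
Definition tends_to_nat f := forall z, 1 <= Re z ->
  (normc (f (z + N%:R) - f N%:R) @[N --> \oo] --> (0 : R))%classic.

Lemma normc_cvg0_le (u : nat -> R[i]) (v : nat -> R) :
  (forall n, normc (u n) <= v n) -> (v @ \oo --> (0 : R))%classic ->
  (normc (u n) @[n --> \oo] --> (0 : R))%classic.
Proof.
move=> uv; apply: squeeze_cvgr; last exact: cvg_cst.
by near=> n; rewrite normc_ge0 uv.
Unshelve. all: by end_near.
Qed.

Lemma tends_to_nat_lin f g a b : tends_to_nat f -> tends_to_nat g ->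
  tends_to_nat (fun z => a * f z + b * g z).
Proof.
move=> hf hg z hz.
apply: (@normc_cvg0_le _ (fun N => normc a * normc (f (z + N%:R) - f N%:R) +
    normc b * normc (g (z + N%:R) - g N%:R))).
  move=> N; rewrite -!ComplexField.Normc.normcM; apply: le_trans _ (normcD_le _ _).
  by rewrite le_eqVlt; apply/orP; left; apply/eqP; congr (Normc.normc _); ring.
have h0 c u : (u @ \oo --> (0 : R))%classic ->
    (c * u N @[N --> \oo] --> (0 : R))%classic.
  by move=> hu; rewrite -(mulr0 c); exact: cvgMr.
by rewrite -[0]addr0; apply: cvgD; apply: h0; [exact: hf|exact: hg].
Qed.

Lemma tends_to_nat_sum (I : Type) (r : seq I) (c : I -> R[i]) (f : I -> R[i] -> R[i]) :
  (forall i, tends_to_nat (f i)) ->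
  tends_to_nat (fun z => \sum_(i <- r) c i * f i z).
Proof.
move=> hf; elim: r => [|i r IHr].
  move=> z hz; apply: (@normc_cvg0_le _ (fun=> 0)); last exact: cvg_cst.
  by move=> N; rewrite !big_nil subrr ComplexField.Normc.normc0.
have -> : (fun z => \sum_(j <- i :: r) c j * f j z) =
    (fun z => c i * f i z + 1 * \sum_(j <- r) c j * f j z).
  by apply/funext => z; rewrite big_cons mul1r.
exact: tends_to_nat_lin.
Qed.

Lemma tends_to_nat_kfun s : tends_to_nat (@kfun R s).
Proof.
move=> z hz; have [D [k HD]] := kfun_shift s hz.
apply: normc_cvg0_le HD _; rewrite -(mulr0 D); apply: cvgMr.
exact: harm_pow_cvg0.
Qed.

(** Products do not preserve [tends_to_nat] in general. Here each difference decays like a power of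
    [harm N] over N+1, which outweighs the logarithmic growth of the other factor. *)
Lemma tends_to_nat_kfunM s t : all (leq 1) s -> all (leq 1) t ->
  tends_to_nat (fun z => kfun s z * kfun t z).
Proof.
move=> s_gt0 t_gt0 z hz.
have [D [k HD]] := kfun_shift s hz; have [E [l HE]] := kfun_shift t hz.
pose h j N : R := harm N ^+ j / N.+1%:R.
apply: (@normc_cvg0_le _ (fun N => D * h k N * (E * h l N) +
   (E * h (size s + l)%N N + D * h (k + size t)%N N))).
  move=> N; have := HD N; have := HE N.
  have := normc_kfun_nat R N s_gt0; have := normc_kfun_nat R N t_gt0.
  set f0 := kfun s N%:R; set g0 := kfun t N%:R.
  set f := kfun s _; set g := kfun t _ => g0_le f0_le dg df.
  have -> : f * g - f0 * g0 =
      (f - f0) * (g - g0) + (f0 * (g - g0) + (f - f0) * g0) by ring.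
  apply: le_trans (normcD_le _ _) _; apply: lerD;
    last (apply: le_trans (normcD_le _ _) _; apply: lerD);
    rewrite ComplexField.Normc.normcM.
  - by apply: ler_pM; rewrite ?normc_ge0.
  - apply: le_trans (ler_pM _ _ f0_le dg) _; rewrite ?normc_ge0 //.
    by rewrite le_eqVlt /h exprD; apply/orP; left; apply/eqP; ring.
  - apply: le_trans (ler_pM _ _ df g0_le) _; rewrite ?normc_ge0 //.
    by rewrite le_eqVlt /h exprD; apply/orP; left; apply/eqP; ring.
have hc c j : (c * h j N @[N --> \oo] --> (0 : R))%classic.
  by rewrite -(mulr0 c); apply: cvgMr; exact: harm_pow_cvg0.
rewrite -[X in (_ --> X)%classic](addr0 0); apply: cvgD.
  by rewrite -[X in (_ --> X)%classic](mulr0 0); apply: cvgM; exact: hc.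
by rewrite -[X in (_ --> X)%classic](addr0 0); apply: cvgD; exact: hc.
Qed.

(* By periodicity f z = f (z' + N) - f N with z' = z + 2, for every N. *)
Lemma periodic_eq0 f : (forall z, -1 < Re z -> f (z + 1) = f z) ->
  f 0 = 0 -> tends_to_nat f -> forall z, -1 < Re z -> f z = 0.
Proof.
move=> f_per f0 f_nat z hz.
have f_pern N w : -1 < Re w -> f (w + N%:R) = f w.
  move=> hw; elim: N => [|N IHN]; first by rewrite addr0.
  by rewrite -natr1 addrA f_per // Re_addn; apply: ltr_wpDr.
have hz2 : 1 <= Re (z + 2) by rewrite Re_addn; lra.
have h0 : -1 < Re (0 : R[i]) by rewrite /= ltrN10.
have := f_nat _ hz2.
under eq_fun => N.
  rewrite f_pern; last by rewrite (lt_le_trans _ hz2) //; lra.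
  rewrite (f_pern 2) // -[N%:R]add0r f_pern // f0 subr0.
  over.
move=> fz; apply: ComplexField.Normc.eq0_normc.
have /cvg_lim := fz; rewrite lim_cst; first exact.
all: exact: Rhausdorff.
Qed.

Definition qs_sum (s t : seq nat) z : R[i] :=
  \sum_(c <- qs s t) (-1) ^+ (size s + size t - size c) * kfun (col_sums c) z.

Lemma qs_sum_nil1 t z : qs_sum [::] t z = kfun t z.
Proof.
rewrite /qs_sum /= big_seq1 size_map subnn mul1r.
by congr kfun; rewrite /col_sums -map_comp; elim: t => //= b t ->.
Qed.

Lemma qs_sum_nil2 s z : qs_sum s [::] z = kfun s z.
Proof.
rewrite /qs_sum quasi_shuffle_nil big_seq1 size_map addn0 subnn mul1r.
congr kfun; rewrite /col_sums -map_comp; elim: s => //= b s ->.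
by rewrite addn0.
Qed.

Lemma qs_sum_cons (y : nat * nat) l n z : (0 < y.1 + y.2)%N -> -1 < Re z ->
  \sum_(c <- [seq y :: c | c <- l])
    (-1) ^+ (n - size c) * kfun (col_sums c) (z + 1) =
  \sum_(c <- [seq y :: c | c <- l]) (-1) ^+ (n - size c) * kfun (col_sums c) z +
  (\sum_(c <- l) (-1) ^+ (n.-1 - size c) * kfun (col_sums c) (z + 1)) /
    (z + 1) ^+ (y.1 + y.2).
Proof.
move=> y_gt0 hz; rewrite !big_map mulr_suml -big_split; apply: eq_bigr => c _.
rewrite [col_sums _]/= kfunS // mulrDr [size _]/= -subn1 -subnDA add1n.
by rewrite mulrA.
Qed.

(** The sum is split by its first column and [kfunS] is applied to that entry. A merged column uses
    two entries at once, whence the minus sign. *)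
Lemma qs_sumS a s b t z : (0 < a)%N -> (0 < b)%N -> -1 < Re z ->
  qs_sum (a :: s) (b :: t) (z + 1) = qs_sum (a :: s) (b :: t) z +
    (qs_sum s (b :: t) (z + 1) / (z + 1) ^+ a +
     qs_sum (a :: s) t (z + 1) / (z + 1) ^+ b -
     qs_sum s t (z + 1) / (z + 1) ^+ (a + b)).
Proof.
move=> a_gt0 b_gt0 hz; rewrite {1 2}/qs_sum quasi_shuffle_cons !big_cat /=.
have a0_gt0 : (0 < a + 0)%N by rewrite addn0.
have ab_gt0 : (0 < a + b)%N by rewrite addn_gt0 a_gt0.
rewrite (@qs_sum_cons (a, 0%N)) // (@qs_sum_cons (0%N, b)) //.
rewrite (@qs_sum_cons (a, b)) //= addn0 add0n.
rewrite -/(qs_sum s (b :: t) (z + 1)).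
have -> : \sum_(c <- qs (a :: s) t)
    (-1) ^+ (size s + (size t).+1 - size c) * kfun (col_sums c) (z + 1) =
    qs_sum (a :: s) t (z + 1).
  by rewrite /qs_sum addnS.
have -> : \sum_(c <- qs s t)
    (-1) ^+ (size s + (size t).+1 - size c) * kfun (col_sums c) (z + 1) =
    - qs_sum s t (z + 1).
  rewrite /qs_sum -sumrN; apply: eq_big_seq => c /size_quasi_shuffle le_c.
  by rewrite addnS subSn // exprS mulN1r mulNr.
ring.
Qed.

Lemma kfun_mul s t z : all (leq 1) s -> all (leq 1) t -> -1 < Re z ->
  kfun s z * kfun t z = qs_sum s t z.
Proof.
elim: s t z => [|a s IHs] t z s_gt0; first by rewrite mul1r qs_sum_nil1.
elim: t z => [|b t IHt] z t_gt0 hz; first by rewrite mulr1 qs_sum_nil2.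
have /andP[a_gt0 s_gt0'] := s_gt0; have /andP[b_gt0 t_gt0'] := t_gt0.
apply/eqP; rewrite -subr_eq0; apply/eqP; move: z hz.
apply: (@periodic_eq0 (fun z =>
  kfun (a :: s) z * kfun (b :: t) z - qs_sum (a :: s) (b :: t) z)).
- move=> z hz; have z1 := z1_neq0 hz; rewrite qs_sumS //.
  have hz1 : -1 < Re (z + 1) by rewrite Re_add1; lra.
  (* If p and q are the increments of the factors F and G, then F G increases by p G(z+1) + F(z+1) q
     - p q. The induction hypotheses turn these products into the three terms of [qs_sumS]. *)
  rewrite -IHs // -IHt // -IHs // !kfunS // exprD; field.
  by rewrite !expf_neq0.
- rewrite kfun_at0 mul0r sub0r /qs_sum quasi_shuffle_cons.
  rewrite big1_seq ?oppr0 // => c; rewrite !mem_cat.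
  by case/or3P => /mapP[d _ ->]; rewrite [col_sums _]/= kfun_at0 mulr0.
- have hM := tends_to_nat_kfunM s_gt0 t_gt0.
  have hQ : tends_to_nat (qs_sum (a :: s) (b :: t)).
    by apply: tends_to_nat_sum => c; exact: tends_to_nat_kfun.
  have := tends_to_nat_lin 1 (-1) hM hQ.
  by congr tends_to_nat; apply/funext => z; rewrite mul1r mulN1r.
Qed.

End Product.

(** * Multi-indices, Newton coefficients and linear extension *)

Section Glue.
Variable R : realType.
Local Open Scope complex_scope.
Local Notation normc := (@complex.ComplexField.Normc.normc R).
Local Notation Re := complex.Re.
Implicit Types z : R[i].

(** The variables stay in ['I_n] while their bound [m] varies, so that splitting off the last
    variable leaves the index type unchanged. With exponents given by a function, only [p]
    changes. *)
Definition bounded_sum (n p : nat) (e : nat -> nat) (m : nat) : R[i] :=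
  \sum_(t : p.-tuple 'I_n | sorted leq [seq val k | k <- t] &&
      all (fun k : 'I_n => (k < m)%N) t)
    \prod_(j < p) ((tnth t j).+1%:R ^+ e j)^-1.

Lemma sorted_map_rcons n (t : seq 'I_n) (k : 'I_n) :
  sorted leq [seq val i | i <- rcons t k] =
  sorted leq [seq val i | i <- t] && all (fun i : 'I_n => (i < k.+1)%N) t.
Proof.
rewrite map_rcons !(sorted_pairwise leq_trans) pairwise_rcons andbC; congr (_ && _).
by rewrite all_map.
Qed.

Lemma bounded_sumS n p e m : bounded_sum n p.+1 e m =
  \sum_(k < n | (k < m)%N) bounded_sum n p e k.+1 / k.+1%:R ^+ e p.
Proof.
pose h (x : 'I_n * p.-tuple 'I_n) : p.+1.-tuple 'I_n := [tuple of rcons x.2 x.1].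
have h_bij : bijective h.
  apply: inj_card_bij.
    move=> [k t] [k' t'] /(congr1 val) /= /rcons_inj [tt' ->].
    by congr (_, _); exact: val_inj.
  by rewrite card_prod !card_tuple card_ord expnS.
rewrite /bounded_sum (reindex h) /=; last exact: onW_bij.
under [RHS]eq_bigr do rewrite mulr_suml.
rewrite pair_big_dep /=; apply: eq_big => [[k t]|[k t] _] /=.
  rewrite sorted_map_rcons all_rcons; case: ltnP => km; rewrite ?andbF //=.
  rewrite -andbA; congr (_ && _); apply/andP/idP => [[]//|tk]; split=> //.
  by apply: sub_all tk => i ik; apply: leq_trans ik _.
rewrite big_ord_recr /=; congr (_ * _).
  apply: eq_bigr => j _; rewrite !(tnth_nth k) /= nth_rcons size_tuple.
  by rewrite ltn_ord.
by rewrite (tnth_nth k) /= nth_rcons size_tuple ltnn eqxx.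
Qed.

(** Induction on [p], then on [m]: for p > 0 both sides vanish at m = 0, and raising [m] by 1 adds
    the same term to each, by [bounded_sumS] and [kfunS]. *)
Lemma bounded_sum_kfun n p e m : (m <= n)%N -> (forall j, (j < p)%N -> (0 < e j)%N) ->
  bounded_sum n p e m = kfun (rev (mkseq e p)) m%:R.
Proof.
elim: p m => [|p IHp] m mn e_gt0.
  rewrite /bounded_sum (big_pred1 [tuple]) ?big_ord0 // => t.
  by rewrite tuple0 /= eqxx.
have revE : rev (mkseq e p.+1) = e p :: rev (mkseq e p).
  by rewrite /mkseq -addn1 iotaD map_cat rev_cat.
rewrite bounded_sumS revE; elim: m mn => [|m IHm] mn.
  by rewrite big_pred0 // kfun_at0.
have e_gt0' j : (j < p)%N -> (0 < e j)%N by move=> jp; apply: e_gt0; exact: ltnW.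
have hm : -1 < Re (m%:R : R[i]).
  rewrite -(rmorph_nat (real_complex R)) /=.
  by apply: lt_le_trans (ler0n _ _); rewrite ltrN10.
have := kfunS (rev (mkseq e p)) (e_gt0 p (ltnSn p)) hm; rewrite natr1 => ->.
rewrite -(IHm (ltnW mn)) (bigD1 (Ordinal mn)) //= IHp // addrC.
congr (_ + _); apply: eq_bigl => k.
by rewrite -val_eqE /= ltnS [RHS]ltn_neqAle andbC.
Qed.

Lemma multiindex_gt0 (mu : multiindex) : all (leq 1) (rev mu).
Proof. by rewrite all_rev; case: mu => s /= /andP[_]. Qed.

Lemma multiindex_rev (mu : multiindex) : exists a s, rev mu = a :: s.
Proof.
case: mu => s /= /andP[s_neq0 _]; case/lastP: s s_neq0 => // s a _.
by exists a, (rev s); rewrite rev_rcons.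
Qed.

Lemma mi_sum_kfun (mu : multiindex) n : mi_sum R mu n = kfun (rev mu) n%:R.
Proof.
rewrite -{1}(mkseq_nth 0%N mu) -(bounded_sum_kfun (leqnn n)).
  apply: eq_bigl => t; rewrite (_ : all _ _ = true) ?andbT //.
  by apply/allP => k _; exact: ltn_ord.
move=> j j_lt; have /allP := multiindex_gt0 mu; apply.
by rewrite mem_rev mem_nth.
Qed.

(** * The transform [nabla] and Newton inversion *)

Lemma nablaS (a : nat -> R[i]) n :
  nabla a n.+1 = nabla a n - nabla (fun k => a k.+1) n.
Proof.
rewrite /nabla big_ord_recl /= bin0 !mul1r.
under eq_bigr => k _ do rewrite /bump /= add1n binS natrD mulrDr mulrDl.
rewrite big_split /= addrA; congr (_ + _); last first.
  by rewrite -sumrN; apply: eq_bigr => k _; rewrite exprS mulN1r !mulNr.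
rewrite [RHS]big_ord_recl /= bin0 !mul1r big_ord_recr /= bin_small //.
rewrite mulr0 mul0r addr0; congr (_ + _).
Qed.

Lemma eq_nabla (a b : nat -> R[i]) n : a =1 b -> nabla a n = nabla b n.
Proof. by move=> ab; apply: eq_bigr => k _; rewrite ab. Qed.

Lemma nablaD (a b : nat -> R[i]) n :
  nabla (fun k => a k + b k) n = nabla a n + nabla b n.
Proof.
by rewrite /nabla -big_split; apply: eq_bigr => k _; rewrite mulrDr.
Qed.

Lemma nabla_sum (I : Type) (r : seq I) (c : I -> R[i]) (a : I -> nat -> R[i]) n :
  nabla (fun k => \sum_(i <- r) c i * a i k) n = \sum_(i <- r) c i * nabla (a i) n.
Proof.
rewrite /nabla; under eq_bigr do rewrite mulr_sumr.
rewrite exchange_big; apply: eq_bigr => i _; rewrite mulr_sumr.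
by apply: eq_bigr => k _; rewrite mulrCA.
Qed.

Lemma nabla0 (a : nat -> R[i]) : nabla a 0 = a 0%N.
Proof. by rewrite /nabla big_ord_recl big_ord0 addr0 bin0 !mul1r. Qed.

Lemma nabla_cst (c : R[i]) n : nabla (fun=> c) n = if n is 0 then c else 0.
Proof. by case: n => [|n]; rewrite ?nabla0 // nablaS subrr. Qed.

Lemma nabla_newton k (b : nat -> R) n : slow k b ->
  nabla (fun N => newton 1 b N%:R) n.+1 = - (b n)%:C.
Proof.
move=> sb.
(* The induction on [n] must cover all [m], since moving from N to N+1 turns [delta m b] into
   [delta m.+1 b]. *)
suff H m : nabla (fun N => newton 1 (delta m b) N%:R) n.+1 = - (delta m b n)%:C.
  exact: H 0%N.
have hN N : -1 < Re (N%:R : R[i]).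
  rewrite -(rmorph_nat (real_complex R)) /=.
  by apply: lt_le_trans (ler0n _ _); rewrite ltrN10.
have newton_natS j N : newton 1 (delta j b) N.+1%:R =
    (delta j b 0)%:C + newton 1 (delta j.+1 b) N%:R.
  by rewrite -natr1 newton1_shift //; exact: decays_delta sb.
elim: n m => [|n IHn] m; rewrite nablaS (eq_nabla _ (newton_natS m)) nablaD.
  by rewrite !nabla0 !newton1_at0 addr0 sub0r.
by rewrite nabla_cst add0r !IHn deltaS rmorphB; ring.
Qed.

Lemma nabla_kfun a s n :
  nabla (fun N => kfun (a :: s) N%:R) n.+1 = - (newton_coef R (a :: s) n)%:C.
Proof. by have [k sk] := slow_newton_coef R a s; exact: nabla_newton sk. Qed.

(** * Linear extension from multi-indices to V *)

Definition mi_lin (phi : multiindex -> R[i]) (v : mi_space) : R[i] :=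
  \sum_(mu <- msupp v) ratr v@_mu * phi mu.

Lemma cvg_lin_sum (I : Type) (r : seq I) (c : I -> R[i]) (u : I -> nat -> R[i]^o)
    (l : I -> R[i]) :
  (forall i, (u i @ \oo --> (l i : R[i]^o))%classic) ->
  ((\sum_(i <- r) c i * u i n : R[i]^o) @[n --> \oo] -->
    (\sum_(i <- r) c i * l i : R[i]^o))%classic.
Proof.
move=> ul; elim: r => [|i r IHr].
  rewrite big_nil; under eq_fun do rewrite big_nil; exact: cvg_cst.
rewrite big_cons; under eq_fun do rewrite big_cons.
apply: cvgD; last exact: IHr.
by apply: cvgMr; exact: ul.
Qed.

Lemma kawashimaFE v z : -1 < Re z ->
  kawashimaF v z = mi_lin (fun mu => kfun (rev mu) z) v.
Proof.
move=> hz; apply: (@cvg_lim (R[i]^o)) => //.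
set f : nat -> R[i]^o := (X in series X).
(* The term of index 0 vanishes because S_mu(0) = 0. Dropping it matches index n+1 here with index n
   of the series with d = 1. *)
rewrite -(cvg_shiftS (series f : nat -> R[i]^o)).
have nablaE n : nabla (mi_sumV R v) n =
    \sum_(mu <- msupp v) ratr v@_mu * nabla (fun N => kfun (rev mu) N%:R) n.
  rewrite -nabla_sum; apply: eq_nabla => N; apply: eq_bigr => mu _.
  by rewrite mi_sum_kfun.
have -> : (fun n => series f n.+1) = (fun n => \sum_(mu <- msupp v) ratr v@_mu *
    series (newton_term 1 (newton_coef R (rev mu)) z) n : R[i]^o).
  apply/funext => n; rewrite series_ordE big_ord_recl [f _]/f nablaE big1_seq.
    rewrite mulr0 mul0r add0r; under [RHS]eq_bigr do rewrite series_ordE mulr_sumr.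
    rewrite exchange_big; apply: eq_bigr => i _ /=; rewrite /f nablaE.
    rewrite mulr_sumr mulr_suml; apply: eq_bigr => mu _.
    have [a [s ->]] := multiindex_rev mu.
    rewrite nabla_kfun /newton_term add1n /bump /= add1n exprS; ring.
  move=> mu _; have [a [s ->]] := multiindex_rev mu.
  by rewrite nabla0 kfun_at0 mulr0.
apply: cvg_lin_sum => mu.
have [a [s ->]] := multiindex_rev mu; rewrite /kfun; apply: newton_cvg => //.
by have [k sk] := slow_newton_coef R a s; exact: slow_decays sk.
Qed.

Lemma mi_linw (d : {fset multiindex}) phi (v : mi_space) : (msupp v `<=` d)%fset ->
  mi_lin phi v = \sum_(mu <- d) ratr v@_mu * phi mu.
Proof.
move=> le_d; apply: (big_fset_incl _ le_d) => mu _ mu_notin.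
by rewrite mcoeff_outdom // rmorph0 mul0r.
Qed.

Lemma mi_linD phi (v w : mi_space) : mi_lin phi (v + w) = mi_lin phi v + mi_lin phi w.
Proof.
rewrite (mi_linw _ (msuppD_le v w)) (mi_linw _ (fsubsetUl (msupp v) (msupp w))).
rewrite (mi_linw _ (fsubsetUr (msupp v) (msupp w))) -big_split.
by apply: eq_bigr => mu _; rewrite mcoeffD rmorphD mulrDl.
Qed.

Lemma mi_linZ phi c (v : mi_space) : mi_lin phi (c *: v) = ratr c * mi_lin phi v.
Proof.
rewrite (mi_linw _ (msuppZ_le c v)) mulr_sumr.
by apply: eq_bigr => mu _; rewrite mcoeffZ rmorphM mulrA.
Qed.

Lemma mi_lin0 phi : mi_lin phi 0 = 0.
Proof. by rewrite /mi_lin msupp0 big_nil. Qed.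

Lemma mi_linU phi mu : mi_lin phi (<< mu >> : mi_space) = phi mu.
Proof. by rewrite /mi_lin msuppU oner_eq0 big_seq_fset1 mcoeffUU rmorph1 mul1r. Qed.

Lemma mi_lin_sum phi (I : Type) (r : seq I) (c : I -> rat) (v : I -> mi_space) :
  mi_lin phi (\sum_(i <- r) c i *: v i) = \sum_(i <- r) ratr (c i) * mi_lin phi (v i).
Proof.
elim: r => [|i r IHr]; first by rewrite !big_nil mi_lin0.
by rewrite !big_cons mi_linD mi_linZ IHr.
Qed.

End Glue.

(** * Quasi-shuffles as matrices *)

Section Matrices.

(* The columns of a matrix, last one first. *)
Definition cols (M : mat2) : seq (nat * nat) :=
  rev [seq (tagged M ord0 j, tagged M ord_max j) | j <- enum 'I_(tag M)].

Definition mat_of_cols (c : seq (nat * nat)) : mat2 :=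
  Tagged (fun l => 'M[nat]_(2, l)) (\matrix_(i < 2, j < size c)
    let x := nth (0%N, 0%N) (rev c) j in if i == ord0 then x.1 else x.2).

Lemma size_cols (M : mat2) : size (cols M) = tag M.
Proof. by rewrite size_rev size_map size_enum_ord. Qed.

Lemma ord2P (i : 'I_2) : i = ord0 \/ i = ord_max.
Proof. by case: i => [[|[|//]] ?]; [left|right]; apply: val_inj. Qed.

Lemma cols_inj : injective cols.
Proof.
move=> M M' eq_cols; have := congr1 size eq_cols; rewrite !size_cols.
case: M M' eq_cols => l M [l' M'] /= eq_cols eq_l.
case: l' / eq_l M' eq_cols => M' /(congr1 rev); rewrite !revK => /eq_in_map eq_M.
congr existT; apply/matrixP => i j.
by have [] := eq_M j (mem_enum _ _); case: (ord2P i) => ->.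
Qed.

Lemma mat_of_colsK : cancel mat_of_cols cols.
Proof.
move=> c; rewrite /cols /=; apply: (canLR revK).
apply: (@eq_from_nth _ (0%N, 0%N)); first by rewrite size_map size_enum_ord size_rev.
move=> i; rewrite size_map size_enum_ord => i_lt.
rewrite (nth_map (Ordinal i_lt)) ?size_enum_ord //.
have -> : nth (Ordinal i_lt) (enum 'I_(size c)) i = Ordinal i_lt.
  by apply: val_inj; rewrite /= nth_enum_ord.
by rewrite !mxE /= -surjective_pairing.
Qed.

Lemma colsK : cancel cols mat_of_cols.
Proof. by move=> M; apply: cols_inj; rewrite mat_of_colsK. Qed.

Lemma colsums_cols (M : mat2) : colsums (tagged M) = rev (col_sums (cols M)).
Proof. by rewrite /col_sums /cols map_rev revK -map_comp. Qed.

Lemma first_row_cols (M : mat2) :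
  first_row (cols M) = rev (nonzero_row (tagged M) ord0).
Proof.
rewrite /first_row /cols map_rev filter_rev; congr (rev (seq.filter _ _)).
exact: (esym (map_comp _ _ _)).
Qed.

Lemma second_row_cols (M : mat2) :
  second_row (cols M) = rev (nonzero_row (tagged M) ord_max).
Proof.
rewrite /second_row /cols map_rev filter_rev; congr (rev (seq.filter _ _)).
exact: (esym (map_comp _ _ _)).
Qed.

Lemma quasi_shufflesE (mu nu : multiindex) (M : mat2) :
  quasi_shuffles mu nu M <-> cols M \in quasi_shuffle_cols (rev mu) (rev nu).
Proof.
rewrite mem_quasi_shuffle ?multiindex_gt0 // first_row_cols second_row_cols.
rewrite /nonzero_cols all_rev all_map !(inj_eq (can_inj revK)); split.
  move=> [_ /eqP rmu /eqP rnu Mpos]; apply/and3P; split=> //.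
  by apply/allP => j _; exact: Mpos.
move=> /and3P[/eqP rmu /eqP rnu /allP Mpos]; split=> //; last first.
  by move=> j; apply: Mpos; rewrite mem_enum.
(* The width is positive because the first row contains the nonempty [mu]. *)
have le_tag : (size (nonzero_row (tagged M) ord0) <= tag M)%N.
  by rewrite size_filter (leq_trans (count_size _ _)) // size_map size_enum_ord.
apply: leq_trans le_tag; rewrite rmu -size_rev.
by have [a [s ->]] := multiindex_rev mu.
Qed.

Lemma mi_prodE (mu nu : multiindex) : mi_prod mu nu =
  \sum_(c <- quasi_shuffle_cols (rev mu) (rev nu))
    (-1) ^+ (size mu + size nu - size c) *:
      (<< to_multiindex (rev (col_sums c)) >> : mi_space).
Proof.
set r := quasi_shuffle_cols _ _.
have r_uniq : uniq (map mat_of_cols r).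
  rewrite map_inj_uniq ?uniq_quasi_shuffle ?multiindex_gt0 //.
  exact: can_inj mat_of_colsK.
rewrite /mi_prod.
have -> : quasi_shuffles mu nu = [set` map mat_of_cols r]%classic.
  apply/seteqP; split => M /=; rewrite quasi_shufflesE -/r.
    by move=> cM; apply/mapP; exists (cols M); rewrite // colsK.
  by move=> /mapP[c cr ->]; rewrite mat_of_colsK.
rewrite -fsbig_seq // big_map; apply: eq_bigr => c _.
by rewrite colsums_cols mat_of_colsK.
Qed.

End Matrices.

Lemma mi_lin_prod (R : realType) (mu nu : multiindex) (z : R[i]) :
  mi_lin (fun la => kfun (rev la) z) (mi_prod mu nu) = qs_sum (rev mu) (rev nu) z.
Proof.
rewrite mi_prodE mi_lin_sum /qs_sum; apply: eq_big_seq => c c_in.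
rewrite mi_linU !size_rev rmorphXn rmorphN1; congr (_ * kfun _ z).
have cM : quasi_shuffles mu nu (mat_of_cols c).
  by rewrite quasi_shufflesE mat_of_colsK.
have := colsums_multiindex cM; rewrite colsums_cols mat_of_colsK => ->.
by rewrite revK.
Qed.

Theorem theorem5p3 (R : realType) (v w : mi_space) (z : R[i])
    (hz : -1 < complex.Re z) :
  kawashimaF v z * kawashimaF w z = kawashimaF (bar_prod v w) z.
Proof.
rewrite !kawashimaFE // /bar_prod.
have -> : \sum_(mu <- msupp v) \sum_(nu <- msupp w) (v@_mu * w@_nu) *: mi_prod mu nu =
    \sum_(mu <- msupp v) v@_mu *: \sum_(nu <- msupp w) w@_nu *: mi_prod mu nu.
  apply: eq_bigr => mu _; rewrite scaler_sumr.
  by apply: eq_bigr => nu _; rewrite scalerA.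
rewrite mi_lin_sum {1}/mi_lin mulr_suml; apply: eq_bigr => mu _.
rewrite mi_lin_sum -[LHS]mulrA; congr (_ * _).
rewrite /mi_lin mulr_sumr; apply: eq_bigr => nu _.
by rewrite -/(mi_lin _ _) mi_lin_prod -kfun_mul ?multiindex_gt0 // mulrCA.
Qed.
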